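(* Let $\bar x\in\mathbb R^n$ and let $f:\mathbb R^n\to\overline{\mathbb R}$ be the function defined by $f(x)=\varphi(x)+\psi(x)$ for every $x\in\mathbb R^n$, where $\varphi:\mathbb R^n\to\overline{\mathbb R}$ is twice differentiable at $\bar x$ in the extended sense, $0\in\nabla\varphi(\bar x)+\partial\psi(\bar x)$, and $\psi:\mathbb R^n\to\overline{\mathbb R}$ is subdifferentially continuous, prox-regular, and twice epi-differentiable at $\bar x$ for $-\nabla\varphi(\bar x)$. Then the following assertions are equivalent: (i) (Quadratic growth) There exist $\kappa>0$ and $\gamma>0$ such that $f(x)-f(\bar x)\ge\frac{\kappa}{2}\|x-\bar x\|^2$ for all $x\in\mathbb B_\gamma(\bar x)$. (ii) The subgradient mapping $\partial f$ is strongly metrically subregular at $(\bar x,0)$, and $\langle\nabla^2\varphi(\bar x)w,w\rangle+d^2\psi(\bar x|-\nabla\varphi(\bar x))(w)\ge 0$ for all $w\in\mathbb R^n$. (iii) The subgradient mapping $\partial f$ is strongly metrically subregular at $(\bar x,0)$, and $\bar x$ is a local minimizer of $f$. (iv) For all $w\in\operatorname{dom}D(\partial\psi)(\bar x|-\nabla\varphi(\bar x))\setminus\{0\}$ and all $z\in D(\partial\psi)(\bar x|-\nabla\varphi(\bar x))(w)$ one has $\langle\nabla^2\varphi(\bar x)w,w\rangle+\langle z,w\rangle>0$. (v) There exists a real number $c>0$ such that $\langle\nabla^2\varphi(\bar x)w,w\rangle+\langle z,w\rangle\ge c\|w\|^2$ for all $w\in\operatorname{dom}D(\partial\psi)(\bar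 x|-\nabla\varphi(\bar x))$ and all $z\in D(\partial\psi)(\bar x|-\nabla\varphi(\bar x))(w)$. (vi) For every $w\in\mathbb R^n\setminus\{0\}$ one has $\langle\nabla^2\varphi(\bar x)w,w\rangle+d^2\psi(\bar x|-\nabla\varphi(\bar x))(w)>0$. Moreover, if one of these assertions holds, then $$\mathrm{QG}(f;\bar x)=\inf\left\{\frac{\langle\nabla^2\varphi(\bar x)w,w\rangle+\langle z,w\rangle}{\|w\|^2}\ \Big|\ w\in\operatorname{dom}D(\partial\psi)(\bar x|-\nabla\varphi(\bar x)),\ z\in D(\partial\psi)(\bar x|-\nabla\varphi(\bar x))(w)\right\},$$ with the convention $0/0=\infty$.
   Context: $\overline{\mathbb R}:=\mathbb R\cup\{\infty\}$; $\operatorname{dom}f=\{x: f(x)<\infty\}$; $\mathbb B_\varepsilon(\bar x)$ is the closed ball of radius $\varepsilon$ around $\bar x$; for a set-valued map $\Phi$, $\operatorname{dom}\Phi=\{w:\Phi(w)\ne\emptyset\}$ and $\operatorname{gph}\Phi=\{(w,z): z\in\Phi(w)\}$. Extended twice differentiability: $f:\mathbb R^n\to\overline{\mathbb R}$, finite at $\bar x$, is twice differentiable at $\bar x$ in the extended sense if it is differentiable at $\bar x$ and there exist an $n\times n$ matrix $A$, a neighborhood $U$ of $\bar x$ and $D\subset U$ with $\mu(U\setminus D)=0$ ($\mu$ Lebesgue measure) such that $f$ is Lipschitz on $U$, differentiable at every point of $D$, and $\lim_{x\to\bar x,\,x\in D}\frac{\nabla f(x)-\nabla f(\bar x)-A(x-\bar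 x)}{\|x-\bar x\|}=0$. The (unique) matrix $A$ is denoted $\nabla^2f(\bar x)$. Subdifferentials: for $\bar x\in\operatorname{dom}f$, the regular subdifferential is $\widehat\partial f(\bar x)=\{v: \liminf_{x\to\bar x}\frac{f(x)-f(\bar x)-\langle v,x-\bar x\rangle}{\|x-\bar x\|}\ge0\}$, and the limiting subdifferential $\partial f(\bar x)$ is the set of $v$ for which there are $x_k\to\bar x$ with $f(x_k)\to f(\bar x)$ and $v_k\to v$ with $v_k\in\widehat\partial f(x_k)$. Both are empty if $\bar x\notin\operatorname{dom}f$. Prox-regularity: $f$ is prox-regular at $\bar x\in\operatorname{dom}f$ for $\bar v\in\partial f(\bar x)$ if there are $r,\varepsilon>0$ such that for all $x,u\in\mathbb B_\varepsilon(\bar x)$ with $|f(u)-f(\bar x)|<\varepsilon$ one has $f(x)\ge f(u)+\langle v,x-u\rangle-\frac r2\|x-u\|^2$ for all $v\in\partial f(u)\cap\mathbb B_\varepsilon(\bar v)$. $f$ is subdifferentially continuous at $\bar x$ for $\bar v$ if $(x_k,v_k)\to(\bar x,\bar v)$ with $v_k\in\partial f(x_k)$ implies $f(x_k)\to f(\bar x)$. Second subderivative: $\Delta_t^2f(\bar x,v)(w'):=\frac{f(\bar x+tw')-f(\bar x)-t\langle v,w'\rangle}{\frac12t^2}$ and $d^2f(\bar x|v)(w):=\liminf_{t\downarrow0,\,w'\to w}\Delta_t^2f(\bar x,v)(w')$. $f$ is twice epi-differentiable at $\bar x$ for $v$ if for every $w\in\mathbb R^n$ and every $t_k\downarrow0$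 there is $w_k\to w$ with $\Delta_{t_k}^2f(\bar x,v)(w_k)\to d^2f(\bar x|v)(w)$. Tangent cone: $T_\Omega(\bar x)=\{v:\exists t_k\downarrow0,\ v_k\to v,\ \bar x+t_kv_k\in\Omega\ \forall k\}$ for $\bar x\in\Omega$. Subgradient graphical derivative of $f$ at $\bar x$ for $\bar v\in\partial f(\bar x)$: $D(\partial f)(\bar x|\bar v)(w):=\{z: (w,z)\in T_{\operatorname{gph}\partial f}(\bar x,\bar v)\}$. Strong metric subregularity: a set-valued map $\Phi:\mathbb R^n\rightrightarrows\mathbb R^n$ with $\bar y\in\Phi(\bar x)$ is strongly metrically subregular at $(\bar x,\bar y)$ if there are $\kappa>0$ and a neighborhood $U$ of $\bar x$ such that $\|x-\bar x\|\le\kappa\,d(\bar y,\Phi(x))$ for all $x\in U$, where $d(\bar y,\emptyset)=\infty$. Exact modulus: $\mathrm{QG}(f;\bar x)$ is the supremum of all $\kappa>0$ for which there is $\gamma>0$ with $f(x)-f(\bar x)\ge\frac\kappa2\|x-\bar x\|^2$ for all $x\in\mathbb B_\gamma(\bar x)$.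
   Formalization: The formal theorem additionally assumes that ψ is lower semicontinuous at every point of some neighborhood of x̄; without it the equivalence fails, e.g. ψ(x)=x²g(x) on the line, g=−1 at irrationals and g(q_k)=−(2−1/k) at the rationals q_k, φ=0, x̄=0: (iv) and (v) hold but (i) and (vi) fail. *)

(* Defs.v *)
From HB Require Import structures.
From mathcomp Require Import all_boot all_order all_algebra.
From mathcomp Require Import all_classical all_reals all_analysis.

Set Implicit Arguments.
Unset Strict Implicit.
Unset Printing Implicit Defensive.

Import Order.TTheory GRing.Theory Num.Theory.
Import numFieldNormedType.Exports.

Local Open Scope classical_set_scope.
Local Open Scope ring_scope.

(* R^n is 'cV[R]_n. The norm `|x| of the library on matrices is the sup norm:
   it induces the usual topology (so nbhs, limits and differentiability below
   are the library's), but all quantitative notions use the Euclidean norm. *)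
Definition dot (R : realType) (n : nat) (u v : 'cV[R]_n) : R :=
  \sum_(i < n) u i 0 * v i 0.

Definition enorm (R : realType) (n : nat) (u : 'cV[R]_n) : R :=
  Num.sqrt (dot u u).

Definition cball (R : realType) (n : nat) (x : 'cV[R]_n) (e : R) :
  set 'cV[R]_n := [set y | enorm (y - x) <= e].

(* Outer Lebesgue measure on R^n, from at most countable covers by boxes; the
   index predicate P allows finite and empty covers, which matters for n = 0.
   A set is Lebesgue measurable of measure 0 iff its outer measure is 0. *)
Definition box (R : realType) (n : nat) (a b : 'cV[R]_n) : set 'cV[R]_n :=
  [set x | forall i, a i 0 <= x i 0 <= b i 0].

Definition box_volume (R : realType) (n : nat) (a b : 'cV[R]_n) : R :=
  \prod_(i < n) (b i 0 - a i 0).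

Definition lebesgue_outer (R : realType) (n : nat) (A : set 'cV[R]_n) :
    \bar R :=
  ereal_inf [set s | exists (P : pred nat) (a b : nat -> 'cV[R]_n),
    [/\ forall k i, a k i 0 <= b k i 0,
        A `<=` \bigcup_(k in [set k | P k]) box (a k) (b k) &
        s = (\sum_(k <oo | P k) (box_volume (a k) (b k))%:E)%E]].

Definition edom (R : realType) (n : nat) (f : 'cV[R]_n -> \bar R) :
  set 'cV[R]_n := [set x | (f x < +oo)%E].

(* Differentiability of an extended-real-valued function entails finiteness
   in a neighborhood, where the function coincides with fine \o f. *)
Definition edifferentiable (R : realType) (n : nat) (f : 'cV[R]_n -> \bar R)
    (x : 'cV[R]_n) : Prop :=
  (\forall y \near x, f y \is a fin_num) /\ differentiable (fine \o f) x.

Definition gradient (R : realType) (n : nat) (f : 'cV[R]_n -> \bar R)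
    (x : 'cV[R]_n) : 'cV[R]_n :=
  \col_(i < n) 'D_(delta_mx i 0) (fine \o f) x.

Definition is_ext_hessian (R : realType) (n : nat) (f : 'cV[R]_n -> \bar R)
    (xbar : 'cV[R]_n) (A : 'M[R]_n) : Prop :=
  edifferentiable f xbar /\
  exists U D : set 'cV[R]_n,
    [/\ nbhs xbar U /\ D `<=` U,
        lebesgue_outer (U `\` D) = 0%E,
        (forall x, U x -> f x \is a fin_num) /\
        (exists L : R, forall x y, U x -> U y ->
           `|fine (f x) - fine (f y)| <= L * enorm (x - y)),
        forall x, D x -> edifferentiable f x &
        (fun x => (enorm (x - xbar))^-1 *:
                  (gradient f x - gradient f xbar - A *m (x - xbar)))
          @ within D (xbar^') --> (0 : 'cV[R]_n)].

Definition ext_twice_differentiable (R : realType) (n : nat)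
    (f : 'cV[R]_n -> \bar R) (xbar : 'cV[R]_n) : Prop :=
  exists A : 'M[R]_n, is_ext_hessian f xbar A.

Definition ext_hessian (R : realType) (n : nat)
    (f : 'cV[R]_n -> \bar R) (xbar : 'cV[R]_n) : 'M[R]_n :=
  xget 0 [set A | is_ext_hessian f xbar A].

Definition reg_subdiff (R : realType) (n : nat) (f : 'cV[R]_n -> \bar R)
    (xbar : 'cV[R]_n) : set 'cV[R]_n :=
  [set v | edom f xbar /\
    (0 <= limf_einf (fun x => (f x - f xbar - (dot v (x - xbar))%:E) *
                              ((enorm (x - xbar))^-1)%:E) (xbar^'))%E].

Definition lim_subdiff (R : realType) (n : nat) (f : 'cV[R]_n -> \bar R)
    (xbar : 'cV[R]_n) : set 'cV[R]_n :=
  [set v | edom f xbar /\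
    exists x_ v_ : nat -> 'cV[R]_n,
      [/\ x_ @ \oo --> xbar, (f \o x_) @ \oo --> f xbar, v_ @ \oo --> v &
          forall k, reg_subdiff f (x_ k) (v_ k)]].

(* Lower semicontinuity at every point of some neighborhood of xbar; cf. the
   global [lower_semicontinuous]. *)
Definition lsc_around (R : realType) (n : nat) (f : 'cV[R]_n -> \bar R)
    (xbar : 'cV[R]_n) : Prop :=
  \forall x \near xbar, forall a : R, (a%:E < f x)%E ->
    \forall y \near x, (a%:E < f y)%E.

Definition prox_regular (R : realType) (n : nat) (f : 'cV[R]_n -> \bar R)
    (xbar vbar : 'cV[R]_n) : Prop :=
  [/\ edom f xbar, lim_subdiff f xbar vbar &
    exists r eps : R, [/\ 0 < r, 0 < eps &
      forall x u, cball xbar eps x -> cball xbar eps u ->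
        (`|f u - f xbar| < eps%:E)%E ->
        forall v, lim_subdiff f u v -> cball vbar eps v ->
          (f u + (dot v (x - u) - r / 2 * enorm (x - u) ^+ 2)%:E <= f x)%E]].

Definition subdiff_continuous (R : realType) (n : nat)
    (f : 'cV[R]_n -> \bar R) (xbar vbar : 'cV[R]_n) : Prop :=
  forall x_ v_ : nat -> 'cV[R]_n,
    x_ @ \oo --> xbar -> v_ @ \oo --> vbar ->
    (forall k, lim_subdiff f (x_ k) (v_ k)) ->
    (f \o x_) @ \oo --> f xbar.

Definition second_diff_quot (R : realType) (n : nat) (f : 'cV[R]_n -> \bar R)
    (xbar v : 'cV[R]_n) (t : R) (w : 'cV[R]_n) : \bar R :=
  ((f (xbar + t *: w)%R - f xbar - (t * dot v w)%:E) *
   ((2^-1 * t ^+ 2)^-1)%:E)%E.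

Definition second_subderiv (R : realType) (n : nat) (f : 'cV[R]_n -> \bar R)
    (xbar v w : 'cV[R]_n) : \bar R :=
  limf_einf (fun p : R * 'cV[R]_n => second_diff_quot f xbar v p.1 p.2)
    (filter_prod (0^'+) (nbhs w)).

Definition twice_epi_differentiable (R : realType) (n : nat)
    (f : 'cV[R]_n -> \bar R) (xbar v : 'cV[R]_n) : Prop :=
  forall (w : 'cV[R]_n) (t_ : nat -> R),
    (forall k, 0 < t_ k) -> t_ @ \oo --> (0 : R) ->
    exists2 w_ : nat -> 'cV[R]_n, w_ @ \oo --> w &
      (fun k => second_diff_quot f xbar v (t_ k) (w_ k)) @ \oo
        --> second_subderiv f xbar v w.

Definition mdom (X Y : Type) (Phi : X -> set Y) : set X :=
  [set w | Phi w !=set0].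

Definition gph (X Y : Type) (Phi : X -> set Y) : set (X * Y) :=
  [set p | Phi p.1 p.2].

Definition tangent_cone (R : realType) (V : normedModType R) (Omega : set V)
    (x : V) : set V :=
  [set v | exists (t_ : nat -> R) (v_ : nat -> V),
    [/\ forall k, 0 < t_ k, t_ @ \oo --> (0 : R), v_ @ \oo --> v &
        forall k, Omega (x + t_ k *: v_ k)]].

Definition subgrad_graph_deriv (R : realType) (n : nat)
    (f : 'cV[R]_n -> \bar R) (xbar vbar w : 'cV[R]_n) : set 'cV[R]_n :=
  [set z | tangent_cone (gph (lim_subdiff f)) (xbar, vbar) (w, z)].

Definition edist (R : realType) (n : nat) (y : 'cV[R]_n) (A : set 'cV[R]_n) :
    \bar R :=
  ereal_inf [set (enorm (y - z))%:E | z in A].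

Definition strongly_subregular (R : realType) (n : nat)
    (Phi : 'cV[R]_n -> set 'cV[R]_n) (xbar ybar : 'cV[R]_n) : Prop :=
  Phi xbar ybar /\
  exists2 kappa : R, 0 < kappa &
    \forall x \near xbar,
      ((enorm (x - xbar))%:E <= kappa%:E * edist ybar (Phi x))%E.

Definition growth_on_ball (R : realType) (n : nat) (f : 'cV[R]_n -> \bar R)
    (xbar : 'cV[R]_n) (kappa gamma : R) : Prop :=
  forall x, cball xbar gamma x ->
    ((kappa / 2 * enorm (x - xbar) ^+ 2)%:E <= f x - f xbar)%E.

Definition QG (R : realType) (n : nat) (f : 'cV[R]_n -> \bar R)
    (xbar : 'cV[R]_n) : \bar R :=
  ereal_sup [set kappa%:E | kappa in
    [set kappa : R | 0 < kappa /\
      exists2 gamma : R, 0 < gamma & growth_on_ball f xbar kappa gamma]].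

Definition local_minimizer (R : realType) (n : nat) (f : 'cV[R]_n -> \bar R)
    (xbar : 'cV[R]_n) : Prop :=
  \forall x \near xbar, (f xbar <= f x)%E.

(* Quotient with the convention 0 / 0 = +oo. *)
Definition ediv0 (R : realType) (a b : R) : \bar R :=
  if (a == 0) && (b == 0) then +oo%E else (a / b)%:E.

(* Main.v *)
Require Import Defs.
From HB Require Import structures.
From mathcomp Require Import all_boot all_order all_algebra.
From mathcomp Require Import all_classical all_reals all_analysis.
From mathcomp Require Import measurable_realfun ring lra.

Set Implicit Arguments.
Unset Strict Implicit.
Unset Printing Implicit Defensive.

Import Order.TTheory GRing.Theory Num.Theory.
Import numFieldNormedType.Exports.

Local Open Scope classical_set_scope.
Local Open Scope ring_scope.

(* Along generic lines parallel to the axes a Lipschitz function is governed by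
   its gradient, so the expansion of grad phi at xbar, valid off a null set,
   gives for every x near xbar a first-order estimate of phi around x with
   error o(|x - xbar|), hence a second-order Taylor expansion at xbar and
   d^2 f (xbar | 0) (w) = <A w, w> + d^2 psi (w) =: q w, which is positive on
   the unit sphere iff f grows quadratically. If q is minimal on the sphere at
   w0, then minimizing penalized difference quotients of psi yields
   z in D(dpsi)(w0) with <A w0, w0> + <z, w0> = q w0; conversely,
   prox-regularity and twice epi-differentiability give d^2 psi w <= <z, w>
   for all z in D(dpsi)(w). So the infima of both quadratic expressions agree.
   If subregularity fails, the first-order estimate turns small subgradients
   of f into subgradients of psi and produces a unit w with -A w in
   D(dpsi)(w), which contradicts (iv); if q vanishes at some w <> 0,
   penalized minimization for f itself contradicts subregularity. *)

(** * The Euclidean norm *)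

(** Two obstacles shape the proof. Away from [xbar] the gradient of [phi] is controlled only off a
    null set, so subgradients of [f] at nearby points do not split exactly. What survives is an
    error proportional to the distance t to [xbar]: a quadratic penalty replaces the approximate
    subgradient of [psi] by a true one at a point displaced by a small multiple of t, and both
    defects stay small after the division by t that defines the tangent cone. Secondly, the null set
    is known only through covers by boxes. A cover of small total volume leaves some slightly
    translated copy of a given axis-parallel segment almost uncovered, which is shown by integrating
    one coordinate at a time. The minimum of q on the sphere is attained because second
    subderivatives are lower semicontinuous; prox-regularity excludes the value -oo, and homogeneity
    of degree two makes a finite minimum on the sphere a global optimality condition. Since [A] is
    not known to be symmetric, that condition is written with its symmetric part, which has the same
    quadratic form. *)

Lemma dotC (R : realType) (n : nat) (u v : 'cV[R]_n) : dot u v = dot v u.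
Proof. by apply: eq_bigr => i _; rewrite mulrC. Qed.

Lemma dotDl (R : realType) (n : nat) (u v w : 'cV[R]_n) :
  dot (u + v) w = dot u w + dot v w.
Proof. by rewrite -big_split; apply: eq_bigr => i _; rewrite !mxE mulrDl. Qed.

Lemma dotZl (R : realType) (n : nat) (a : R) (u v : 'cV[R]_n) :
  dot (a *: u) v = a * dot u v.
Proof. by rewrite mulr_sumr; apply: eq_bigr => i _; rewrite !mxE mulrA. Qed.

Lemma dotDr (R : realType) (n : nat) (u v w : 'cV[R]_n) :
  dot w (u + v) = dot w u + dot w v.
Proof. by rewrite !(dotC w) dotDl. Qed.

Lemma dotZr (R : realType) (n : nat) (a : R) (u v : 'cV[R]_n) :
  dot u (a *: v) = a * dot u v.
Proof. by rewrite !(dotC u) dotZl. Qed.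

Lemma dotNl (R : realType) (n : nat) (u v : 'cV[R]_n) : dot (- u) v = - dot u v.
Proof. by rewrite -scaleN1r dotZl mulN1r. Qed.

Lemma dotNr (R : realType) (n : nat) (u v : 'cV[R]_n) : dot u (- v) = - dot u v.
Proof. by rewrite !(dotC u) dotNl. Qed.

Lemma dot0l (R : realType) (n : nat) (u : 'cV[R]_n) : dot 0 u = 0.
Proof. by rewrite -(scale0r u) dotZl mul0r. Qed.

Lemma dot0r (R : realType) (n : nat) (u : 'cV[R]_n) : dot u 0 = 0.
Proof. by rewrite dotC dot0l. Qed.

Definition dotE := (dotDl, dotDr, dotZl, dotZr, dotNl, dotNr, dot0l, dot0r).

Lemma dot_ge0 (R : realType) (n : nat) (u : 'cV[R]_n) : 0 <= dot u u.
Proof. by apply: sumr_ge0 => i _; rewrite -expr2 sqr_ge0. Qed.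

Lemma enorm_ge0 (R : realType) (n : nat) (u : 'cV[R]_n) : 0 <= enorm u.
Proof. exact: sqrtr_ge0. Qed.

Lemma enorm_sqr (R : realType) (n : nat) (u : 'cV[R]_n) : enorm u ^+ 2 = dot u u.
Proof. by rewrite sqr_sqrtr ?dot_ge0. Qed.

Lemma enorm0 (R : realType) (n : nat) : enorm (0 : 'cV[R]_n) = 0.
Proof. by rewrite /enorm dot0l sqrtr0. Qed.

Lemma enormZ (R : realType) (n : nat) (a : R) (u : 'cV[R]_n) :
  enorm (a *: u) = `|a| * enorm u.
Proof. by rewrite /enorm !dotE mulrA -expr2 sqrtrM ?sqr_ge0// sqrtr_sqr. Qed.

Lemma enormN (R : realType) (n : nat) (u : 'cV[R]_n) : enorm (- u) = enorm u.
Proof. by rewrite -scaleN1r enormZ normrN1 mul1r. Qed.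

Lemma enormB (R : realType) (n : nat) (u v : 'cV[R]_n) :
  enorm (u - v) = enorm (v - u).
Proof. by rewrite -enormN opprB. Qed.

Lemma ler_norm_enorm (R : realType) (n : nat) (u : 'cV[R]_n) : `|u| <= enorm u.
Proof.
rewrite /Num.norm/= mx_normrE.
apply: bigmax_le => [|[i j] _]; first exact: enorm_ge0.
rewrite -ler_sqr ?nnegrE ?enorm_ge0 ?normr_ge0// enorm_sqr/= (ord1 j).
rewrite /dot (bigD1 i)//= real_normK ?num_real// expr2 lerDl.
by apply: sumr_ge0 => k _; rewrite -expr2 sqr_ge0.
Qed.

Lemma ler_coord_norm (R : realType) (n : nat) (u : 'cV[R]_n) (i : 'I_n) :
  `|u i 0| <= `|u|.
Proof. by rewrite [X in _ <= X]/Num.norm/= mx_normrE; apply: (le_bigmax _ _ (i, 0)). Qed.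

Lemma enorm_eq0 (R : realType) (n : nat) (u : 'cV[R]_n) : (enorm u == 0) = (u == 0).
Proof.
apply/idP/eqP => [/eqP e0|->]; last by rewrite enorm0.
by apply/eqP; rewrite -normr_le0 -e0 ler_norm_enorm.
Qed.

Lemma enorm_gt0 (R : realType) (n : nat) (u : 'cV[R]_n) : (0 < enorm u) = (u != 0).
Proof. by rewrite lt_def enorm_ge0 andbT enorm_eq0. Qed.

Lemma enorm1_neq0 (R : realType) (n : nat) (u : 'cV[R]_n) : enorm u = 1 -> u <> 0.
Proof. by move=> u1 u0; move/eqP: u1; rewrite u0 enorm0 eq_sym oner_eq0. Qed.

Lemma enorm_normalize (R : realType) (n : nat) (u : 'cV[R]_n) :
  u != 0 -> enorm ((enorm u)^-1 *: u) = 1.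
Proof.
by rewrite -enorm_gt0 => u0; rewrite enormZ gtr0_norm ?invr_gt0// mulVf// gt_eqF.
Qed.

Lemma ler_dot_enorm (R : realType) (n : nat) (u v : 'cV[R]_n) :
  `|dot u v| <= enorm u * enorm v.
Proof.
rewrite -ler_sqr ?nnegrE ?mulr_ge0 ?enorm_ge0 ?normr_ge0//.
rewrite real_normK ?num_real// exprMn !enorm_sqr.
have [->|v0] := eqVneq v 0; first by rewrite !dotE expr0n/= mulr0.
have v1 : 0 < dot v v by rewrite -enorm_sqr exprn_gt0// enorm_gt0.
(* This square expands to [dot v v] times the gap in the squared Cauchy-Schwarz inequality. *)
have := dot_ge0 (dot v v *: u - dot u v *: v).
rewrite !dotE (dotC v u) => h.
rewrite -subr_ge0 -(pmulr_rge0 _ v1).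
by apply: le_trans h _; rewrite le_eqVlt; apply/orP; left; apply/eqP; ring.
Qed.

Lemma ler_dot (R : realType) (n : nat) (u v : 'cV[R]_n) : dot u v <= enorm u * enorm v.
Proof. exact: le_trans (ler_norm _) (ler_dot_enorm _ _). Qed.

Lemma ler_enormD (R : realType) (n : nat) (u v : 'cV[R]_n) :
  enorm (u + v) <= enorm u + enorm v.
Proof.
rewrite -ler_sqr ?nnegrE ?addr_ge0 ?enorm_ge0// sqrrD !enorm_sqr !dotE (dotC v u).
by have := ler_dot u v; lra.
Qed.

Lemma ler_enorm_dist (R : realType) (n : nat) (x y z : 'cV[R]_n) :
  enorm (x - z) <= enorm (x - y) + enorm (y - z).
Proof. by apply: le_trans (ler_enormD _ _); rewrite addrA subrK. Qed.

Lemma ler_enorm_norm (R : realType) (n : nat) (u : 'cV[R]_n) :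
  enorm u <= n%:R * `|u|.
Proof.
rewrite -ler_sqr ?nnegrE ?enorm_ge0 ?mulr_ge0 ?normr_ge0 ?ler0n// enorm_sqr.
apply: (@le_trans _ _ (\sum_(i < n) `|u| ^+ 2)).
  apply: ler_sum => i _; rewrite -expr2 -(real_normK (num_real (u i 0))).
  by rewrite ler_sqr ?nnegrE ?normr_ge0// ler_coord_norm.
rewrite sumr_const card_ord exprMn -[leLHS]mulr_natl.
rewrite ler_wpM2r ?sqr_ge0//.
by rewrite -natrX ler_nat; case: (n) => // k; rewrite leq_pmulr.
Qed.

Lemma ler_mulmx_enorm (R : realType) (n : nat) (A : 'M[R]_n) :
  exists2 K : R, 0 < K & forall u, enorm (A *m u) <= K * enorm u.
Proof.
pose K := \sum_i \sum_j `|A i j|.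
have K0 : 0 <= K by apply: sumr_ge0 => i _; apply: sumr_ge0.
exists (n%:R * K + 1) => [|u].
  by rewrite ltr_wpDl ?mulr_ge0 ?ler0n.
apply: (le_trans (ler_enorm_norm _)).
rewrite mulrDl mul1r -mulrA ler_wpDr ?enorm_ge0// ler_wpM2l ?ler0n//.
rewrite /Num.norm/= mx_normrE.
apply: bigmax_le => [|[i j] _]; first by rewrite mulr_ge0 ?enorm_ge0.
rewrite /= mxE (ord1 j); apply: le_trans (ler_norm_sum _ _ _) _.
rewrite [K](bigD1 i)//= mulrDl ler_wpDr//.
  by rewrite mulr_ge0 ?enorm_ge0//; apply: sumr_ge0 => k _; apply: sumr_ge0.
rewrite mulr_suml; apply: ler_sum => k _; rewrite normrM ler_wpM2l//.
exact: le_trans (ler_coord_norm _ _) (ler_norm_enorm _).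
Qed.

(** * Topology and compactness in terms of the Euclidean norm *)

Lemma nbhs_enormP (R : realType) (n : nat) (x : 'cV[R]_n) (P : set 'cV[R]_n) :
  nbhs x P <-> exists2 e : R, 0 < e & forall y, enorm (y - x) < e -> P y.
Proof.
split.
  move=> /nbhs_ballP[e /= e0 eP]; exists e => // y yx; apply: eP.
  rewrite -ball_normE/= distrC; exact: le_lt_trans (ler_norm_enorm _) yx.
(* The factor [n.+1] dominates the ratio [n] of the two norms and stays invertible for [n = 0]. *)
move=> [e e0 eP]; apply/nbhs_ballP; exists (e / n.+1%:R) => /=.
  by rewrite divr_gt0// ltr0Sn.
move=> y; rewrite -ball_normE/= distrC => yx; apply: eP.
apply: (le_lt_trans (ler_enorm_norm _)).
apply: (@le_lt_trans _ _ (n.+1%:R * `|y - x|)).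
  by rewrite ler_wpM2r// ler_nat.
by rewrite mulrC -ltr_pdivlMr ?ltr0Sn.
Qed.

Lemma cvg_enormP (R : realType) (n : nat) (u : nat -> 'cV[R]_n) (l : 'cV[R]_n) :
  u @ \oo --> l <-> forall e : R, 0 < e -> \forall k \near \oo, enorm (u k - l) < e.
Proof.
split=> [ul e e0|h A /nbhs_enormP[e e0 eA]].
  by apply: (ul [set y | enorm (y - l) < e]); apply/nbhs_enormP; exists e.
by apply: filterS (h e e0) => k /eA.
Qed.

Lemma enorm_near (R : realType) (n : nat) (x : 'cV[R]_n) (e : R) : 0 < e ->
  \forall y \near x, enorm (y - x) < e.
Proof. by move=> e0; apply/nbhs_enormP; exists e. Qed.

Lemma continuous_coord (R : realType) (n : nat) (i : 'I_n) :
  continuous (fun u : 'cV[R]_n => u i 0 : R).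
Proof. exact: coord_continuous. Qed.

Lemma cvg_dot (R : realType) (n : nat) (T : Type) (F : set_system T)
    (u v : T -> 'cV[R]_n) (a b : 'cV[R]_n) : Filter F ->
  u @ F --> a -> v @ F --> b -> (fun x => dot (u x) (v x)) @ F --> dot a b.
Proof.
move=> FF ua vb; rewrite /dot.
apply: (@cvg_big R _ +%R 0 xpredT _ T F).
  exact: (@add_continuous R).
move=> i _; apply: cvgM.
- exact: (cvg_comp _ _ ua (@continuous_coord _ _ i a)).
- exact: (cvg_comp _ _ vb (@continuous_coord _ _ i b)).
Qed.

Lemma cvg_enorm (R : realType) (n : nat) (T : Type) (F : set_system T)
    (u : T -> 'cV[R]_n) (a : 'cV[R]_n) : Filter F ->
  u @ F --> a -> (fun x => enorm (u x)) @ F --> enorm a.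
Proof.
move=> FF ua; rewrite /enorm.
apply: (@continuous_cvg _ _ _ _ _ _ Num.sqrt); first exact: sqrt_continuous.
exact: cvg_dot.
Qed.

Lemma continuous_mulmx (R : realType) (n : nat) (A : 'M[R]_n) :
  continuous (fun u : 'cV[R]_n => A *m u).
Proof.
have [K K0 AK] := ler_mulmx_enorm A.
move=> x B /nbhs_enormP[e e0 eB]; apply/nbhs_enormP; exists (e / K) => [|y yx].
  exact: divr_gt0.
apply: eB; rewrite -mulmxBr; apply: le_lt_trans (AK _) _.
by rewrite mulrC -ltr_pdivlMr.
Qed.

Lemma compact_enorm (R : realType) (n : nat) (K : set 'cV[R]_n) (M : R) :
  (forall x, K x -> enorm x <= M) -> closed K -> compact K.
Proof.
move=> KM Kcl.
have trmxc : continuous (fun u : 'rV[R]_n => u^T : 'cV[R]_n).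
  move=> u B /nbhs_ballP[e /= e0 eB]; apply/nbhs_ballP; exists e => //= v.
  case=> _ uv; apply: eB; split=> // i j; rewrite !mxE; exact: uv.
(* Heine-Borel, [bounded_closed_compact], is applied to row vectors; [K] is then the continuous
   image of a compact set under transposition. *)
have -> : K = (fun u : 'rV[R]_n => u^T) @` [set u | K u^T].
  rewrite eqEsubset; split=> [x Kx|x [u Ku <-]//].
  by exists x^T => /=; rewrite trmxK.
apply: continuous_compact.
  by apply: continuous_subspaceT => x; exact: trmxc.
apply: bounded_closed_compact; last exact: (proj1 (continuous_closedP _) trmxc).
exists M; split; first exact: num_real.
move=> N MN u /= /KM uM; apply: le_trans (ltW MN); apply: le_trans uM.
apply: le_trans (ler_norm_enorm _).
rewrite ![`|_|]/Num.norm/= !mx_normrE; apply: bigmax_le => [|[i j] _].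
  by rewrite -mx_normrE -[X in _ <= X]/(`|u^T|) normr_ge0.
by apply: le_trans (le_bigmax _ _ (j, i)); rewrite /= mxE.
Qed.

Lemma compact_cball (R : realType) (n : nat) (x : 'cV[R]_n) (e : R) :
  compact (cball x e).
Proof.
apply: (@compact_enorm _ _ _ (e + enorm x)) => [y ye|].
  by rewrite -[y](subrK x); apply: le_trans (ler_enormD _ _) _; rewrite lerD2r.
have -> : cball x e = (fun y => enorm (y - x)) @^-1` [set r | r <= e] by [].
apply: preimage_closed; last exact: closed_le.
move=> y _.
apply: (@cvg_enorm _ _ _ (nbhs y) (fun y => y - x)).
by apply: cvgB; [exact: cvg_id|exact: cvg_cst].
Qed.

Lemma compact_sphere (R : realType) (n : nat) (x : 'cV[R]_n) (e : R) :
  compact [set y : 'cV[R]_n | enorm (y - x) = e].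
Proof.
apply: (subclosed_compact _ (@compact_cball _ _ x e)) => [|y /= ye];
  last by rewrite /cball/= ye.
have -> : [set y : 'cV[R]_n | enorm (y - x) = e] =
  (fun y => enorm (y - x)) @^-1` [set e] by [].
apply: preimage_closed; last exact: closed_eq.
move=> y _.
apply: (@cvg_enorm _ _ _ (nbhs y) (fun y => y - x)).
by apply: cvgB; [exact: cvg_id|exact: cvg_cst].
Qed.

(** * Lower semicontinuity and regular subgradients *)

Lemma limf_einf_ge (T : choiceType) (X : filteredType T) (R : realType)
    (f : X -> \bar R) (F : set_system X) (c : R) :
  (forall e : R, 0 < e -> F [set x | ((c - e)%:E <= f x)%E]) ->
  (c%:E <= limf_einf f F)%E.
Proof.
move=> h; apply/lee_addgt0Pr => e e0.
rewrite -leeBlDr// -EFinB limf_einfE.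
apply: le_trans (ereal_sup_ubound _); last by eexists; [exact: (h e e0)|].
by apply: le_ereal_inf_tmp => _ [x /= xe <-].
Qed.

Lemma limf_einf_gt (T : choiceType) (X : filteredType T) (R : realType)
    (f : X -> \bar R) (F : set_system X) (c : \bar R) : Filter F ->
  (c < limf_einf f F)%E -> \forall x \near F, (c < f x)%E.
Proof.
move=> FF; rewrite limf_einfE => /ereal_sup_gt[_ [V FV <-] cV].
apply: filterS FV => x Vx; apply: lt_le_trans cV _.
by apply: ereal_inf_lbound; exists x.
Qed.

Lemma limf_einf_lt (T : choiceType) (X : filteredType T) (R : realType)
    (f : X -> \bar R) (F : set_system X) (c : \bar R) (V : set X) :
  (limf_einf f F < c)%E -> F V -> exists2 x, V x & (f x < c)%E.
Proof.
move=> h FV; have : (ereal_inf (f @` V) < c)%E.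
  apply: le_lt_trans h; rewrite limf_einfE.
  by apply: ereal_sup_ubound; exists V.
by move=> /ereal_inf_lt[_ [x Vx <-] xc]; exists x.
Qed.

Lemma lte_dense_EFin (R : realType) (x y : \bar R) : (x < y)%E ->
  exists2 a : R, (x < a%:E)%E & (a%:E < y)%E.
Proof.
case: x => [x| |]; case: y => [y| |] // xy.
- by exists ((x + y) / 2); move: xy; rewrite !lte_fin; lra.
- by exists (x + 1); rewrite ?ltry// lte_fin; lra.
- by exists (y - 1); rewrite ?ltNyr// lte_fin; lra.
- by exists 0; rewrite ?ltNyr// ltry.
Qed.

Definition lsc_at (R : realType) (X : topologicalType) (F : X -> \bar R) (x : X) :=
  forall a : R, (a%:E < F x)%E -> \forall y \near x, (a%:E < F y)%E.

(** If no minimum exists, the sublevel sets in [K] generate a filter along which, near each point of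
    [K], the values of [F] drop strictly below. Compactness in near-covering form makes this uniform
    over [K], so some [y] in [K] would satisfy [F y < F y]. *)
Lemma lsc_attains_min (R : realType) (X : topologicalType) (F : X -> \bar R)
    (K : set X) : compact K -> K !=set0 -> (forall x, K x -> lsc_at F x) ->
  exists2 x, K x & forall y, K y -> (F x <= F y)%E.
Proof.
move=> /compact_near_coveringP Kc [x0 Kx0] Flsc; apply: contrapT => nomin.
have below x : K x -> exists2 y, K y & (F y < F x)%E.
  move=> Kx; apply: contrapT => nox; apply: nomin; exists x => // y Ky.
  by rewrite leNgt; apply/negP => yx; apply: nox; exists y.
pose G := filter_from K (fun y => [set z | K z /\ (F z <= F y)%E]).
have FG : Filter G.
  apply: filter_from_filter; first by exists x0.
  move=> y z Ky Kz; have [yz|zy] := leP (F y) (F z).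
    exists y => // t [Kt ty]; split; split=> //; exact: le_trans yz.
  by exists z => // t [Kt tz]; split; split=> //; exact: le_trans (ltW zy).
have [] := Kc X G (fun i x => (F i < F x)%E) FG.
  move=> x Kx; have [y Ky yx] := below x Kx.
  have [a ya ax] : exists2 a : R, (F y < a%:E)%E & (a%:E < F x)%E.
    exact: lte_dense_EFin.
  exists ([set x' | (a%:E < F x')%E], [set z | K z /\ (F z <= F y)%E]).
    by split=> /=; [exact: Flsc|exists y].
  by move=> [x' z] /= [ax' [Kz zy]]; apply: le_lt_trans zy (lt_trans ya ax').
move=> y Ky /(_ y) /= h; have := h (conj Ky (lexx _)) y Ky.
by rewrite ltxx.
Qed.

Lemma lsc_at_addr (R : realType) (X : topologicalType) (F : X -> \bar R)
    (q : X -> R) (x : X) : {for x, continuous q} -> lsc_at F x ->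
  lsc_at (fun y => F y + (q y)%:E)%E x.
Proof.
move=> qc Flsc a.
rewrite -lteBlDr// -EFinB => /lte_dense_EFin[b ab bF].
have q1 : \forall y \near x, a - b < q y.
  by apply: (cvgr_gt (q x) qc); rewrite lte_fin in ab; lra.
near=> y; rewrite -lteBlDr// -EFinB.
apply: (@lt_trans _ _ b%:E); last by near: y; exact: Flsc.
rewrite lte_fin; have : a - b < q y by near: y.
by lra.
Unshelve. all: by end_near. Qed.

(** The quadratic term is negligible against [enorm (y - x)], whatever the sign of [c]. In this form
    minimizers of quadratically penalized functions yield regular subgradients. *)
Lemma reg_subdiffI (R : realType) (n : nat) (F : 'cV[R]_n -> \bar R)
    (x u : 'cV[R]_n) (c : R) : F x \is a fin_num ->
  (\forall y \near x,
    (F x + (dot u (y - x) - c * enorm (y - x) ^+ 2)%:E <= F y)%E) ->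
  reg_subdiff F x u.
Proof.
move=> Fx h; split; first by rewrite /edom/= ltey_eq Fx.
apply: limf_einf_ge => e e0; rewrite sub0r.
have c0 : 0 < `|c| + 1 by rewrite ltr_wpDl.
have : \forall y \near x, enorm (y - x) < e / (`|c| + 1).
  by apply: enorm_near; exact: divr_gt0.
move=> yx; near=> y.
have y0 : 0 < enorm (y - x).
  rewrite enorm_gt0 subr_eq0; near: y; exact: nbhs_dnbhs_neq.
have ye : enorm (y - x) < e / (`|c| + 1) by near: y; exact: nbhs_dnbhs.
have : (F x + (dot u (y - x) - c * enorm (y - x) ^+ 2)%:E <= F y)%E.
  by near: y; exact: nbhs_dnbhs.
rewrite /= -(fineK Fx); case: (F y) => [b| |].
- rewrite -!EFinD -EFinM !lee_fin => H.
  rewrite ler_pdivlMr//.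
  rewrite ltr_pdivlMr// mulrDr mulr1 in ye.
  have := ler_norm c; nra.
- by move=> _; rewrite addye// gt0_mulye ?lte_fin ?invr_gt0// leey.
- by rewrite leeNy_eq.
Unshelve. all: by end_near. Qed.

Lemma reg_subdiffE (R : realType) (n : nat) (F : 'cV[R]_n -> \bar R)
    (x u : 'cV[R]_n) (e : R) : F x \is a fin_num -> reg_subdiff F x u -> 0 < e ->
  \forall y \near x, (F x + (dot u (y - x) - e * enorm (y - x))%:E <= F y)%E.
Proof.
move=> Fx [_ h] e0.
have h1 : ((- e)%:E < limf_einf (fun y => (F y - F x - (dot u (y - x))%:E) *
    ((enorm (y - x))^-1)%:E) (x^'))%E.
  by apply: lt_le_trans h; rewrite lte_fin oppr_lt0.
have h2 : \forall y \near x, y != x -> ((- e)%:E < (F y - F x - (dot u (y - x))%:E) *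
    ((enorm (y - x))^-1)%:E)%E.
  exact: limf_einf_gt h1.
apply: filterS h2 => y; have [->|yx] := eqVneq y x.
  by rewrite subrr dot0r enorm0 mulr0 subrr adde0.
move=> /(_ isT).
have y0 : 0 < enorm (y - x) by rewrite enorm_gt0 subr_eq0.
rewrite -(fineK Fx); case: (F y) => [b| |].
- by rewrite -!EFinD -EFinM lte_fin lee_fin ltr_pdivlMr//; lra.
- by rewrite leey.
- by rewrite ?addNye gt0_mulNye ?lte_fin ?invr_gt0// ltNge leNye.
Qed.

Lemma reg_subdiff_lim (R : realType) (n : nat) (F : 'cV[R]_n -> \bar R)
    (x u : 'cV[R]_n) : reg_subdiff F x u -> lim_subdiff F x u.
Proof.
move=> Fxu; split; first by case: Fxu.
by exists (fun=> x), (fun=> u); split=> //; exact: cvg_cst.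
Qed.

(** * Quadratic penalties *)

Lemma dot_mulmx (R : realType) (n : nat) (C : 'M[R]_n) (u v : 'cV[R]_n) :
  dot (C *m u) v = dot u (C^T *m v).
Proof.
have dotmx (a b : 'cV[R]_n) : dot a b = (a^T *m b) 0 0.
  by rewrite mxE; apply: eq_bigr => i _; rewrite mxE.
by rewrite !dotmx trmx_mul mulmxA.
Qed.

Definition quad (R : realType) (n : nat) (b : 'cV[R]_n) (C : 'M[R]_n)
  (u : 'cV[R]_n) : R := dot b u + 2^-1 * dot (C *m u) u.

Lemma quadB (R : realType) (n : nat) (b : 'cV[R]_n) (C : 'M[R]_n)
    (u v : 'cV[R]_n) : C^T = C ->
  quad b C v - quad b C u =
  dot (b + C *m u) (v - u) + 2^-1 * dot (C *m (v - u)) (v - u).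
Proof.
move=> CT; have E : dot (C *m v) u = dot (C *m u) v.
  by rewrite dot_mulmx CT dotC.
by rewrite /quad !mulmxBr !dotE E; field.
Qed.

Lemma cvg_mulmx (R : realType) (n : nat) (T : Type) (F : set_system T)
    (A : 'M[R]_n) (u : T -> 'cV[R]_n) (a : 'cV[R]_n) : Filter F ->
  u @ F --> a -> (fun x => A *m u x) @ F --> A *m a.
Proof. by move=> FF ua; exact: (cvg_comp _ _ ua (@continuous_mulmx _ _ A a)). Qed.

Lemma cvg_quad (R : realType) (n : nat) (T : Type) (F : set_system T)
    (b : 'cV[R]_n) (C : 'M[R]_n) (u : T -> 'cV[R]_n) (a : 'cV[R]_n) : Filter F ->
  u @ F --> a -> (fun x => quad b C (u x)) @ F --> quad b C a.
Proof.
move=> FF ua; apply: cvgD; first by apply: cvg_dot => //; exact: cvg_cst.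
by apply: cvgM; [exact: cvg_cst|apply: cvg_dot => //; exact: cvg_mulmx].
Qed.

(** The sphere is too high to carry a minimizer of the penalized function over the closed ball, so
    the minimizer is interior and Fermat's rule applies: the negative gradient of the penalty is a
    subgradient, because the penalty differs from its linearization by at most a multiple of the
    squared distance. *)
Lemma interior_min_reg_subdiff (R : realType) (n : nat) (F : 'cV[R]_n -> \bar R)
    (x0 : 'cV[R]_n) (rho : R) (b : 'cV[R]_n) (C : 'M[R]_n) (p : 'cV[R]_n) :
  C^T = C -> (forall x, F x <> -oo%E) ->
  (forall x, cball x0 rho x -> lsc_at F x) ->
  cball x0 rho p -> (F p < +oo)%E ->
  (forall y, enorm (y - x0) = rho ->
    (F p + (quad b C (p - x0))%:E < F y + (quad b C (y - x0))%:E)%E) ->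
  exists y, [/\ enorm (y - x0) < rho,
    (F y + (quad b C (y - x0))%:E <= F p + (quad b C (p - x0))%:E)%E &
    reg_subdiff F y (- (b + C *m (y - x0)))].
Proof.
move=> CT FN Flsc px0 Fp bd.
pose q y := quad b C (y - x0).
have qc : continuous q.
  move=> y; apply: (@cvg_quad R n _ (nbhs y) b C (fun y => y - x0) (y - x0)).
  by apply: cvgB; [exact: cvg_id|exact: cvg_cst].
have [y yx0 ymin] : exists2 y, cball x0 rho y & forall z, cball x0 rho z ->
    (F y + (q y)%:E <= F z + (q z)%:E)%E.
  apply: (lsc_attains_min (@compact_cball _ _ _ _)); first by exists p.
  by move=> x xx0; apply: lsc_at_addr (qc x) (Flsc _ xx0).
have yp := ymin p px0.
have Fy : F y \is a fin_num.
  move: yp (FN y); case: (F y) => //.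
  by move: Fp; case: (F p).
have yrho : enorm (y - x0) < rho.
  rewrite lt_neqAle yx0 andbT; apply/eqP => /bd; rewrite ltNge.
  by move/negP; apply.
exists y; split=> //.
have [K K0 CK] := ler_mulmx_enorm C.
apply: (@reg_subdiffI _ _ _ _ _ K) => //.
have : \forall z \near y, enorm (z - y) < rho - enorm (y - x0).
  by apply: enorm_near; rewrite subr_gt0.
apply: filterS => z zy.
have : cball x0 rho z.
  rewrite /cball/=; apply: le_trans (ler_enorm_dist z y x0) _.
  by rewrite -lerBrDr ltW.
move=> /ymin; rewrite -(fineK Fy); case: (F z) (FN z) => [c| |] // _; last first.
  by move=> _; rewrite leey.
rewrite -!EFinD !lee_fin => yz.
have := quadB b (y - x0) (z - x0) CT; rewrite -/(q y) -/(q z) => E.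
have zyE : z - x0 - (y - x0) = z - y by rewrite opprB addrA subrK.
rewrite {}zyE dotDl in E; rewrite dotNl dotDl.
have := ler_dot (C *m (z - y)) (z - y).
have : enorm (C *m (z - y)) * enorm (z - y) <= K * enorm (z - y) ^+ 2.
  by rewrite expr2 mulrA ler_wpM2r ?enorm_ge0.
have : 0 <= K * enorm (z - y) ^+ 2 by rewrite mulr_ge0 ?sqr_ge0// ltW.
by lra.
Qed.

(* A quadratic penalty of large curvature moves the approximate subgradient
   [v0] by at most twice its defect [eta]. *)
Lemma approx_reg_subdiff (R : realType) (n : nat) (F : 'cV[R]_n -> \bar R)
    (x v0 : 'cV[R]_n) (eta rho : R) : (forall z, F z <> -oo%E) ->
  (\forall z \near x, lsc_at F z) -> F x \is a fin_num -> 0 <= eta -> 0 < rho ->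
  (\forall y \near x, (F x + (dot v0 (y - x) - eta * enorm (y - x))%:E <= F y)%E) ->
  exists y v, [/\ enorm (y - x) < rho, enorm (v - v0) <= 2 * eta & reg_subdiff F y v].
Proof.
move=> FN /nbhs_enormP[r1 r10 Flsc] Fx eta0 rho0 /nbhs_enormP[r2 r20 low].
pose r := Num.min rho (Num.min r1 r2) / 2.
have r0 : 0 < r by rewrite divr_gt0// !lt_min rho0 r10.
have [rr rr1 rr2] : [/\ r < rho, r < r1 & r < r2].
  have : r < Num.min rho (Num.min r1 r2) by move: r0; rewrite /r; lra.
  by rewrite !lt_min => /and3P[].
(* With [c * r > 2 * eta] the penalty beats the defect on the sphere. At the minimizer, [c / 2]
   times the squared displacement is at most [eta] times the displacement; hence the gradient
   [c *: (y - x)] of the penalty has norm at most [2 * eta]. *)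
pose c := 2 * eta / r + 1.
have h0 : 0 <= 2 * eta / r.
  by apply: divr_ge0; [exact: mulr_ge0|exact: ltW].
have c0 : 0 < c by rewrite /c; lra.
have cr : 2 * eta < c * r.
  have -> : c * r = 2 * eta + r by rewrite /c; field; rewrite gt_eqF.
  by rewrite ltrDl.
have qE u : quad (- v0) c%:M u = - dot v0 u + c / 2 * enorm u ^+ 2.
  by rewrite /quad mul_scalar_mx !dotE enorm_sqr; field.
have xx : cball x r x by rewrite /cball/= subrr enorm0 ltW.
have [||||||y [yr yx ysub]] := @interior_min_reg_subdiff _ _ F x r (- v0) c%:M x.
- by rewrite tr_scalar_mx.
- exact: FN.
- by move=> z zx; apply: Flsc; exact: le_lt_trans zx rr1.
- exact: xx.
- by rewrite ltey_eq Fx.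
- move=> z zr; have := low z; rewrite zr => /(_ rr2).
  rewrite !qE subrr dot0r enorm0 zr -(fineK Fx).
  case: (F z) (FN z) => [d| |] // _; last by move=> _; rewrite -EFinD /= ltry.
  by rewrite -!EFinD lee_fin lte_fin; nra.
have yr2 : enorm (y - x) < r2 by exact: lt_trans yr rr2.
exists y, (- (- v0 + c%:M *m (y - x))); split=> //; first exact: lt_trans yr rr.
have -> : - (- v0 + c%:M *m (y - x)) - v0 = - (c *: (y - x)).
  by rewrite mul_scalar_mx opprD opprK addrAC subrr add0r.
rewrite enormN enormZ gtr0_norm//.
have := low y yr2; move: yx; rewrite !qE subrr dot0r enorm0 -(fineK Fx).
case: (F y) (FN y) => [d| |] // _.
rewrite -!EFinD !lee_fin; have := enorm_ge0 (y - x).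
have [->|y0] := eqVneq (enorm (y - x)) 0; first by rewrite mulr0 => _ _ _; lra.
move=> yge; have {y0 yge} y0 : 0 < enorm (y - x) by rewrite lt_def y0.
move=> h1 h2; rewrite -(ler_pM2r y0); nra.
Qed.

(** * Mean value estimates off a null set *)

(** Let [tau] be the supremum of the times up to which [F] stays below [F a]. The condition from the
    left shows that [tau] is such a time itself, and the condition from the right moves past [tau]
    unless it equals [b]. *)
Lemma real_induction_le (R : realType) (F : R -> R) (a b : R) : a <= b ->
  (forall t, a <= t -> t < b -> exists2 d, 0 < d &
    forall u, t <= u -> u < t + d -> u <= b -> F u <= F t) ->
  (forall t, a < t -> t <= b -> forall e, 0 < e -> exists2 d, 0 < d &
    forall u, t - d < u -> u <= t -> F t <= F u + e) ->
  F b <= F a.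
Proof.
move=> ab Fr Fl.
pose S := [set t | a <= t <= b /\ forall u, a <= u -> u <= t -> F u <= F a].
have Sa : S a.
  split; first by rewrite lexx.
  by move=> u au ua; have -> : u = a by apply: le_anti; rewrite ua.
have Sub : ubound S b by move=> t [/andP[]].
have hS : has_sup S by split; [exists a|exists b].
pose tau := sup S.
have atau : a <= tau by apply: ub_le_sup => //; exists b.
have taub : tau <= b by apply: ge_sup => //; exists a.
have Fbelow u : a <= u -> u < tau -> F u <= F a.
  move=> au utau; have [|s [_ Ss] us] := @sup_adherent _ S (tau - u) _ hS.
    by rewrite subr_gt0.
  by apply: Ss => //; apply: ltW; move: us; rewrite -/tau; lra.
have Ftau : F tau <= F a.
  have [<-//|atau'] := eqVneq a tau.
  have {}atau' : a < tau by rewrite lt_neqAle atau'.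
  apply/ler_addgt0Pr => e e0; have [d d0 dF] := Fl _ atau' taub e e0.
  pose u := Num.max a (tau - d / 2).
  have [au utau ud] : [/\ a <= u, u < tau & tau - d < u].
    by rewrite /u; split; rewrite ?le_max ?gt_max ?lt_max ?lexx//; lra.
  by apply: (le_trans (dF u ud (ltW utau))); rewrite lerD2r Fbelow.
have [<-//|taub'] := eqVneq tau b.
have {}taub' : tau < b by rewrite lt_neqAle taub'.
have [d d0 dF] := Fr _ atau taub'.
pose s := Num.min b (tau + d / 2).
have [sb taus sd] : [/\ s <= b, tau < s & s < tau + d].
  by rewrite /s; split; rewrite ?ge_min ?lt_min ?gt_min ?lexx ?taub'//=; lra.
suff : s <= tau by rewrite leNgt taus.
apply: ub_le_sup; first by exists b.
split; first by rewrite sb andbT (le_trans atau) ?ltW.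
move=> u au us; have [utau|tauu] := ltP u tau; first exact: Fbelow.
by apply: le_trans Ftau; apply: dF => //; lra.
Qed.

Lemma lebesgue_le (R : realType) (A B : set R) :
  measurable A -> measurable B -> A `<=` B ->
  (lebesgue_measure A <= lebesgue_measure B)%E.
Proof. by move=> mA mB AB; apply: le_measure => //; rewrite inE. Qed.

(* The measure of [J] below [t], inflated to an open set, pays for the
   growth of [s] at the points where the slope bound is unavailable. *)
Lemma lipschitz_ae_growth (R : realType) (s : R -> R) (l L eta : R) (J : set R) :
  0 < l -> 0 < L -> measurable J ->
  (forall t u : R, 0 <= t -> t <= l -> 0 <= u -> u <= l -> s u - s t <= L * `|u - t|) ->
  (forall t : R, 0 <= t -> t < l -> ~ J t -> forall e, 0 < e -> exists2 d, 0 < d &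
    forall u, t <= u -> u < t + d -> u <= l -> s u - s t <= (eta + e) * (u - t)) ->
  ((s l - s 0 - eta * l)%:E <= (L + `|eta|)%:E * lebesgue_measure J)%E.
Proof.
move=> l0 L0 mJ sL sJ.
pose K := L + `|eta|.
have K0 : 0 < K by rewrite ltr_wpDr.
have [muJ|] := ltP (lebesgue_measure J) +oo%E; last first.
  by rewrite leye_eq => /eqP ->; rewrite gt0_muley ?lte_fin// leey.
have muJf : lebesgue_measure J \is a fin_num by rewrite ge0_fin_numE.
rewrite -(fineK muJf) -EFinM lee_fin; set j := fine _.
apply/ler_addgt0Pr => d d0.
(* The total tolerance [d] is split in two: the excess of the open hull over [J] costs
   [K * (d / (2 * K))], the excess slope [sg] below costs [sg * l], and each is [d / 2]. *)
have e0 : 0 < d / (2 * K) by rewrite divr_gt0 ?mulr_gt0.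
have [V [Vo JV VJ]] := lebesgue_regularity_outer mJ muJ e0.
have mV : measurable V by exact: open_measurable.
have muV : (lebesgue_measure V <= (j + d / (2 * K))%:E)%E.
  have -> : V = J `|` (V `\` J) by rewrite setDUK.
  apply: le_trans (measureU2 _ _ _) _ => //; first exact: measurableD.
  by rewrite EFinD /j fineK// leeD2l// ltW.
pose Q t := V `&` `[0, t]%classic.
have mQ t : measurable (Q t) by exact: measurableI.
have Qle t u : t <= u -> (lebesgue_measure (Q t) <= lebesgue_measure (Q u))%E.
  move=> tu; apply: lebesgue_le => //.
  by move=> x [Vx /=]; rewrite ?in_itv/= => /andP[x0 xt]; split => //=;
    rewrite ?in_itv/= x0 (le_trans xt).
have QV t : (lebesgue_measure (Q t) <= lebesgue_measure V)%E.
  by apply: lebesgue_le => // x [].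
have Qf t : lebesgue_measure (Q t) \is a fin_num.
  by rewrite ge0_fin_numE//; apply: le_lt_trans (QV t) (le_lt_trans muV (ltry _)).
pose M t := fine (lebesgue_measure (Q t)).
have Mle t u : t <= u -> M t <= M u by move=> tu; rewrite fine_le ?Qle.
have MV t : M t <= j + d / (2 * K).
  by rewrite -lee_fin /M fineK//; exact: le_trans (QV t) muV.
have M0 t : 0 <= M t by rewrite fine_ge0.
have Mincr t u : 0 <= t -> t <= u -> (forall x, t <= x -> x <= u -> V x) ->
    M t + (u - t) <= M u.
  move=> t0 tu tuV; rewrite -lee_fin EFinD /M !fineK//.
  have -> : (u - t)%:E = lebesgue_measure `]t, u]%classic.
    by rewrite lebesgue_measure_itv/= lte_fin; case: ltgtP tu => // <-; rewrite subrr.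
  rewrite -measureU; [|exact: mQ|exact: measurable_itv|]; last first.
    rewrite -subset0 => x [[_ /=]]; rewrite ?in_itv/= => /andP[_ xt] /andP[tx _].
    by move: (lt_le_trans tx xt); rewrite ltxx.
  apply: lebesgue_le; [|exact: mQ|].
    by apply: measurableU; [exact: mQ|exact: measurable_itv].
  move=> x [[Vx /=]|/=]; rewrite ?in_itv/= => /andP[h1 h2].
    by split => //=; rewrite ?in_itv/= h1 (le_trans h2).
  by split; [exact: tuV (ltW h1) h2|rewrite /= ?in_itv/= h2 (le_trans t0)// ltW].
pose sg := d / (2 * l).
have sg0 : 0 < sg by rewrite divr_gt0 ?mulr_gt0.
(* [F] does not increase. At a point of the open set [V], [M] gains at unit rate to the right, so
   the term [K * M] absorbs both [L] and the absolute value of [eta]; at other points the slope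
   hypothesis applies with [e := sg]. *)
pose F t := s t - (eta + sg) * t - K * M t.
have nn := ler_norm (- eta); rewrite normrN in nn.
have : F l <= F 0.
  apply: real_induction_le; first exact: ltW.
  - move=> t t0 tl; have [Vt|nVt] := pselect (V t).
      have /nbhs_ballP[r /= r0 rV] : nbhs t V by exact: open_nbhs_nbhs.
      exists r => // u tu ur ul.
      have : M t + (u - t) <= M u.
        apply: Mincr => // x tx xu; apply: rV; rewrite /ball/= distrC ger0_norm; lra.
      have := sL t u t0 (ltW tl) (le_trans t0 tu) ul.
      rewrite ger0_norm ?subr_ge0// /F /K => h1 h2.
      have : (L + `|eta|) * (M t + (u - t)) <= (L + `|eta|) * M u.
        by rewrite ler_pM2l.
      have h3 : (- eta) * (u - t) <= `|eta| * (u - t).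
        by rewrite ler_wpM2r ?subr_ge0.
      have h4 : 0 <= sg * (u - t) by rewrite mulr_ge0 ?subr_ge0// ltW.
      lra.
    have [//|r r0 rs] := sJ t t0 tl _ sg sg0; first by move=> /JV.
    exists r => // u tu ur ul; have := rs u tu ur ul.
    have : K * M t <= K * M u by rewrite ler_pM2l// Mle.
    by rewrite /F; lra.
  - move=> t t0 tl e e0'.
    pose r := Num.min t (e / (K + 1)).
    have r0 : 0 < r by rewrite lt_min t0 divr_gt0// addr_gt0.
    exists r => // u tu ut.
    have rt : r <= t by rewrite /r ge_min lexx.
    have re : r * (K + 1) <= e.
      by rewrite -ler_pdivlMr; [rewrite /r ge_min lexx orbT|lra].
    have u0 : 0 <= u by lra.
    have := sL u t u0 (le_trans ut tl) (ltW t0) tl.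
    rewrite ger0_norm ?subr_ge0// => h1.
    have : K * M u <= K * M t by rewrite ler_pM2l// Mle.
    have h2 : 0 <= K * (u - (t - r)) by rewrite mulr_ge0 ?subr_ge0 ?ltW.
    have h3 : (- eta) * (t - u) <= `|eta| * (t - u).
      by rewrite ler_wpM2r ?subr_ge0.
    have h4 : 0 <= sg * (t - u) by rewrite mulr_ge0 ?subr_ge0// ltW.
    rewrite /F; move: re h1 h2 h3 h4; rewrite /K; lra.
rewrite /F => h.
have h1 : K * M l <= K * j + d / 2.
  apply: (@le_trans _ _ (K * (j + d / (2 * K)))); first by rewrite ler_pM2l.
  by rewrite mulrDr le_eqVlt; apply/orP; left; apply/eqP; field; rewrite gt_eqF.
have h2 : sg * l = d / 2 by rewrite /sg; field; rewrite gt_eqF.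
have h3 : 0 <= K * M 0 by rewrite mulr_ge0// ltW.
by rewrite -/K; lra.
Qed.

(** Integrate the pointwise inequality over [[al, be]] and exchange sum and integral: the part of
    [[a k, b k]] inside has length at most [b k - a k]. *)
Lemma weighted_interval_cover (R : realType) (w a b : nat -> R) (al be c : R) :
  (forall k, 0 <= w k) -> (forall k, a k <= b k) -> al <= be -> 0 <= c ->
  (forall s, al <= s <= be ->
    (c%:E <= \sum_(k <oo) (w k * (a k <= s <= b k)%R%:R)%:E)%E) ->
  ((c * (be - al))%:E <= \sum_(k <oo) (w k * (b k - a k))%:E)%E.
Proof.
move=> w0 ab albe c0 cov.
pose D := `[al, be]%classic : set R.
have mD : measurable D by exact: measurable_itv.
have itvE (x y : R) : x <= y -> lebesgue_measure (`[x, y]%classic : set R) = (y - x)%:E.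
  by move=> xy; rewrite lebesgue_measure_itv/= lte_fin; case: ltgtP xy => // <-; rewrite subrr.
have indE k s : (w k * (a k <= s <= b k)%R%:R)%:E =
    ((w k)%:E * (\1_(`[a k, b k]%classic) s)%:E)%E.
  by rewrite indicE -EFinM; congr (_ * _)%:E; rewrite mem_setE in_itv.
have mI k : measurable_fun D (fun s : R => (\1_(`[a k, b k]%classic) s)%:E : \bar R).
  by apply/measurable_EFinP; exact: measurable_indic.
have mF k : measurable_fun D (fun s : R => (w k * (a k <= s <= b k)%R%:R)%:E).
  rewrite (_ : (fun s => _) =
      (fun s => (w k)%:E * (\1_(`[a k, b k]%classic) s)%:E)%E).
    by apply: measurable_funeM; exact: mI.
  by apply/funext => s; exact: indE.
have -> : (c * (be - al))%:E = (\int[lebesgue_measure]_(s in D) (cst c%:E s))%E.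
  by rewrite integral_cst//= itvE// -EFinM.
apply: (@le_trans _ _ (\int[lebesgue_measure]_(s in D)
    \sum_(k <oo) (w k * (a k <= s <= b k)%R%:R)%:E)%E).
  apply: ge0_le_integral => //.
  apply: (eq_measurable_fun (fun s => \sum_(k <oo | k \in xpredT)
      (w k * (a k <= s <= b k)%R%:R)%:E)%E) => //.
  apply: ge0_emeasurable_sum => [k s _ _|k _].
    by rewrite lee_fin mulr_ge0.
  exact: mF.
rewrite integral_nneseries//; last first.
  by move=> k s _; rewrite lee_fin mulr_ge0.
apply: lee_nneseries => [k _ _|k _].
  by apply: integral_ge0 => s _; rewrite lee_fin mulr_ge0.
under eq_integral do rewrite indE.
have -> : (\int[lebesgue_measure]_(s in D)
    ((w k)%:E * (\1_(`[a k, b k]%classic) s)%:E) =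
    (w k)%:E * \int[lebesgue_measure]_(s in D) (\1_(`[a k, b k]%classic) s)%:E)%E.
  apply: ge0_integralZl_EFin; [exact: mD| |exact: mI|exact: w0].
  by move=> s _; rewrite lee_fin.
rewrite integral_indic// EFinM lee_wpmul2l ?lee_fin//.
by rewrite -itvE//; apply: lebesgue_le => //; exact: measurableI.
Qed.

(** A Tonelli argument with one-dimensional integrals only. For a frozen value [t] of the first
    coordinate, its indicator is absorbed into the weights and the induction hypothesis treats the
    other coordinates; the resulting inequality, valid for every [t], is integrated by
    [weighted_interval_cover]. *)
Lemma weighted_box_cover (R : realType) (I : eqType) (s : seq I)
    (w : nat -> R) (a b : nat -> I -> R) (al be : I -> R) (c : R) :
  uniq s -> (forall k, 0 <= w k) -> (forall k i, a k i <= b k i) ->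
  (forall i, al i <= be i) -> 0 <= c ->
  (forall p : I -> R, (forall i, al i <= p i <= be i) ->
    (c%:E <= \sum_(k <oo)
      (w k * \prod_(i <- s) (a k i <= p i <= b k i)%R%:R)%:E)%E) ->
  ((c * \prod_(i <- s) (be i - al i))%:E <=
    \sum_(k <oo) (w k * \prod_(i <- s) (b k i - a k i))%:E)%E.
Proof.
move=> + + ab albe; elim: s w c => [|j s IH] w c /=.
  move=> _ w0 c0 /(_ al); rewrite big_nil mulr1.
  under eq_eseriesr do rewrite big_nil.
  under [in X in _ -> X]eq_eseriesr do rewrite big_nil.
  by apply=> i; rewrite lexx albe.
move=> /andP[js us] w0 c0 cov.
have prod0 k : 0 <= \prod_(i <- s) (b k i - a k i).
  by apply: prodr_ge0 => i _; rewrite subr_ge0.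
under eq_eseriesr do rewrite big_cons mulrCA mulrC.
rewrite big_cons mulrCA mulrC.
apply: weighted_interval_cover => //.
- by move=> k; exact: mulr_ge0.
- by rewrite mulr_ge0// prodr_ge0// => i _; rewrite subr_ge0.
move=> t tj.
under eq_eseriesr do rewrite mulrAC.
apply: IH => // [k|p pb]; first by rewrite mulr_ge0.
(* Overwriting coordinate [j] does not affect the remaining factors, since [j] does not occur in
   [s]. *)
have := cov (fun i => if i == j then t else p i).
under eq_eseriesr do rewrite big_cons eqxx mulrA.
under [in X in _ -> X]eq_eseriesr.
  move=> k _.
  rewrite (_ : \prod_(i <- s) _ =
    \prod_(i <- s) (a k i <= (if i == j then t else p i) <= b k i)%R%:R); last first.
    rewrite big_seq [RHS]big_seq; apply: eq_bigr => i si.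
    by case: eqVneq => // ij; rewrite ij (negbTE js) in si.
  over.
by apply=> i; case: eqVneq => [->|].
Qed.

Lemma derivable_slope (R : realType) (n : nat) (h : 'cV[R]_n -> R)
    (y v : 'cV[R]_n) (eta e : R) : derivable h y v -> 'D_v h y <= eta -> 0 < e ->
  exists2 d, 0 < d & forall u, 0 <= u -> u < d ->
    h (y + u *: v) - h y <= (eta + e) * u.
Proof.
move=> dv Dle e0.
have : (fun u => u^-1 *: ((h \o shift y) (u *: v) - h y)) @ 0^' --> 'D_v h y by exact: dv.
move=> /cvgr_lt /(_ (eta + e)).
have H : 'D_v h y < eta + e by apply: le_lt_trans Dle _; rewrite ltrDl.
move=> /(_ H) => /nbhs_ballP[d /= d0 dh]; exists d => // u u0 ud.
have [->|un0] := eqVneq u 0; first by rewrite scale0r addr0 subrr mulr0.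
have {}u0 : 0 < u by rewrite lt_def un0.
have := dh u; rewrite /ball/= sub0r normrN gtr0_norm// => /(_ ud un0).
rewrite /= /shift/= [u *: v + y]addrC => slope.
have {}slope : u^-1 * (h (y + u *: v) - h y) < eta + e by exact: slope.
by rewrite ltW// mulrC -ltr_pdivrMl.
Qed.

Lemma norm_delta (R : realType) (n : nat) (i : 'I_n) :
  `|delta_mx i 0 : 'cV[R]_n| <= 1.
Proof.
rewrite /Num.norm/= mx_normrE; apply: bigmax_le => // -[j k] _ /=.
by rewrite mxE; case: (_ && _); rewrite ?normr1 ?normr0.
Qed.

Lemma ler_norm_coord (R : realType) (n : nat) (u : 'cV[R]_n) (c : R) : 0 <= c ->
  (forall i, `|u i 0| <= c) -> `|u| <= c.
Proof.
move=> c0 uc; rewrite /Num.norm/= mx_normrE.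
by apply: bigmax_le => // -[i j] _ /=; rewrite (ord1 j).
Qed.

(* Fubini in disguise: every line parallel to the segment and close to it
   must meet any cover of the exceptional set in a length bounded below. *)
Lemma segment_growth (R : realType) (n : nat) (h : 'cV[R]_n -> R)
    (U D : set 'cV[R]_n) (x a : 'cV[R]_n) (r L l eta : R) (i : 'I_n) :
  lebesgue_outer (U `\` D) = 0%E ->
  (forall y, `|y - x| < r -> U y) -> 0 < L ->
  (forall y z, U y -> U z -> h y - h z <= L * `|y - z|) ->
  (forall y, D y -> `|y - x| < r ->
    derivable h y (delta_mx i 0) /\ 'D_(delta_mx i 0) h y <= eta) ->
  0 < l -> `|a - x| < r -> `|a + l *: delta_mx i 0 - x| < r ->
  h (a + l *: delta_mx i 0) - h a <= eta * l.
Proof.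
set ei : 'cV[R]_n := delta_mx i 0.
move=> UD0 rU L0 hL hD l0 ar alr.
rewrite leNgt; apply/negP => gap.
pose G := h (a + l *: ei) - h a - eta * l.
have G0 : 0 < G by rewrite subr_gt0.
pose K := L + `|eta|.
have K0 : 0 < K by rewrite ltr_wpDr.
pose r0 := r - Num.max `|a - x| `|a + l *: ei - x|.
have r00 : 0 < r0 by rewrite subr_gt0 gt_max ar.
(* A translation by at most [del] keeps the segment in the ball of radius [r], and changes [h] at
   the two endpoints by at most [G / 2] altogether. *)
pose del := Num.min (r0 / 2) (G / (4 * L)).
have del0 : 0 < del.
  by rewrite lt_min !divr_gt0// mulr_gt0.
have delr : del < r0.
  by apply: (@le_lt_trans _ _ (r0 / 2)); [rewrite /del ge_min lexx|lra].
have delG : 4 * (L * del) <= G.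
  have : del <= G / (4 * L) by rewrite /del ge_min lexx orbT.
  by rewrite ler_pdivlMr ?mulr_gt0//; lra.
(* A translated segment still exceeds the slope bound by [G / 2], so by [lipschitz_ae_growth] the
   cover meets it in length at least [c]. The [V] below is therefore a lower bound for the volume of
   every cover. *)
pose c := G / (2 * K).
have c0 : 0 < c by rewrite divr_gt0 ?mulr_gt0.
pose s := [seq j <- enum 'I_n | j != i].
have us : uniq s by rewrite filter_uniq ?enum_uniq.
pose V := c * \prod_(j <- s) ((a j 0 + del) - (a j 0 - del)).
have V0 : 0 < V.
  by rewrite mulr_gt0// prodr_gt0// => j _; rewrite subr_gt0; lra.
have : (lebesgue_outer (U `\` D) < V%:E)%E by rewrite UD0 lte_fin.
move=> /ereal_inf_lt[_ [P [A [B [AB cov ->]]]]].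
(* The length of box [k] in direction [i], set to 0 outside [P], so that the restricted sum becomes
   a full series. *)
pose w k := (P k)%:R * (B k i 0 - A k i 0).
have w0 k : 0 <= w k by rewrite mulr_ge0// subr_ge0.
have volE : (\sum_(k <oo | P k) (box_volume (A k) (B k))%:E =
    \sum_(k <oo) (w k * \prod_(j <- s) (B k j 0 - A k j 0))%:E)%E.
  rewrite eseries_mkcond; apply: eq_eseriesr => k _.
  rewrite /w /box_volume (bigD1 i)//= /s big_filter big_enum_cond/= -mulrA.
  by case: (P k); rewrite ?mul1r// !mul0r.
rewrite volE ltNge => /negP; apply; rewrite /V.
apply: (@weighted_box_cover R _ s w (fun k j => A k j 0) (fun k j => B k j 0)
  (fun j => a j 0 - del) (fun j => a j 0 + del)) => //.
- by move=> j; lra.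
- exact: ltW.
move=> p pa.
pose q : 'cV[R]_n := \col_j (if j == i then a j 0 else p j).
have qa : `|q - a| <= del.
  apply: ler_norm_coord; first exact: ltW.
  move=> j; rewrite !mxE; case: eqVneq => _; first by rewrite subrr normr0 ltW.
  by have := pa j; rewrite ler_norml => /andP[p1 p2]; apply/andP; split; lra.
pose good k := P k && [forall j : 'I_n, (j != i) ==> (A k j 0 <= p j <= B k j 0)].
pose J k : set R := if good k then `[A k i 0 - a i 0, B k i 0 - a i 0]%classic else set0.
have mJ k : measurable (J k).
  by rewrite /J; case: ifP => _; [exact: measurable_itv|exact: measurable0].
have muJ k : lebesgue_measure (J k) =
    (w k * \prod_(j <- s) (A k j 0 <= p j <= B k j 0)%R%:R)%:E.
  rewrite /J; case: ifPn => [/andP[Pk /forallP pk]|].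
    rewrite lebesgue_measure_itv/= lte_fin big1_seq ?mulr1 /w ?Pk ?mul1r.
      have := AB k i; rewrite le_eqVlt ltrD2r => /orP[/eqP ->|->].
        by rewrite ltxx subrr.
      by rewrite -EFinB; congr (_%:E); ring.
    move=> j /andP[_]; rewrite mem_filter => /andP[ji _].
    by have /implyP -> := pk j.
  rewrite negb_and measure0 => /orP[/negbTE Pk|]; first by rewrite /w Pk !mul0r.
  move=> /forallPn[j]; rewrite negb_imply => /andP[ji /negbTE pj].
  have js : j \in s by rewrite mem_filter ji mem_enum.
  by rewrite (bigD1_seq j)//= pj mul0r mulr0.
have inball t : 0 <= t -> t <= l -> `|q + t *: ei - x| < r.
  move=> t0 tl.
  set m := Num.max `|a - x| `|a + l *: ei - x|.
  have m1 : `|a - x| <= m by rewrite /m le_max lexx.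
  have m2 : `|a + l *: ei - x| <= m by rewrite /m le_max lexx orbT.
  have -> : q + t *: ei - x = (q - a) + ((1 - t / l) *: (a - x) +
      (t / l) *: (a + l *: ei - x)).
    by apply/colP => j; rewrite !mxE; field; rewrite gt_eqF.
  have tl0 : 0 <= t / l by rewrite divr_ge0// ltW.
  have tl1 : 0 <= 1 - t / l by rewrite subr_ge0 ler_pdivrMr// mul1r.
  have h1 := ler_normD (q - a) ((1 - t / l) *: (a - x) + (t / l) *: (a + l *: ei - x)).
  have h2 := ler_normD ((1 - t / l) *: (a - x)) ((t / l) *: (a + l *: ei - x)).
  rewrite (normrZ (1 - t / l) (a - x)) (normrZ (t / l) (a + l *: ei - x)) in h2.
  rewrite (ger0_norm tl0) (ger0_norm tl1) in h2.
  have h3 : (1 - t / l) * `|a - x| <= (1 - t / l) * m by rewrite ler_wpM2l.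
  have h4 : t / l * `|a + l *: ei - x| <= t / l * m by rewrite ler_wpM2l.
  have h5 : del + m < r by move: delr; rewrite /r0 -/m; lra.
  apply: le_lt_trans h5; apply: (le_trans h1); apply: lerD => //.
  apply: (le_trans h2); apply: (le_trans (lerD h3 h4)).
  by rewrite -mulrDl subrK mul1r.
have Kgr : ((h (q + l *: ei) - h (q + 0 *: ei) - eta * l)%:E <=
    K%:E * lebesgue_measure (\bigcup_k J k))%E.
  apply: (@lipschitz_ae_growth R (fun t => h (q + t *: ei))) => //.
  - exact: bigcup_measurable.
  - move=> t u t0 tl u0 ul; apply: le_trans (hL _ _ _ _) _; try exact/rU/inball.
    rewrite ler_pM2l// opprD addrACA subrr add0r -scalerBl normrZ.
    by rewrite ler_piMr// norm_delta.
  move=> t t0 tl nJ e e0.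
  have qt := inball t t0 (ltW tl).
  have Dq : D (q + t *: ei).
    apply: contrapT => nD; apply: nJ.
    have [k /= Pk qk] := cov _ (conj (rU _ qt) nD).
    exists k => //; rewrite /J ifT.
      have := qk i; rewrite !mxE !eqxx/= mulr1 /= in_itv/=.
      by move=> /andP[h1 h2]; apply/andP; split; lra.
    apply/andP; split => //; apply/forallP => j; apply/implyP => ji.
    by have := qk j; rewrite !mxE (negbTE ji)/= mulr0 addr0.
  have [der Dle] := hD _ Dq qt.
  have [d d0 hd] := derivable_slope der Dle e0.
  exists d => // u tu ud ul.
  have := hd (u - t); rewrite subr_ge0 => /(_ tu).
  rewrite -addrA -scalerDl [t + _]addrC subrK; apply; lra.
have : (G / 2 <= h (q + l *: ei) - h (q + 0 *: ei) - eta * l).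
  rewrite scale0r addr0.
  have q0 : `|q - x| < r by have := inball 0 (lexx _) (ltW l0); rewrite scale0r addr0.
  have h1 := hL _ _ (rU _ q0) (rU _ ar).
  have h2 := hL _ _ (rU _ alr) (rU _ (inball l (ltW l0) (lexx _))).
  rewrite opprD addrACA subrr addr0 distrC in h2.
  have h3 : L * `|q - a| <= L * del by rewrite ler_pM2l.
  by rewrite /G in delG *; lra.
move=> Gle.
have : ((G / 2)%:E <= K%:E * \sum_(k <oo)
    (w k * \prod_(j <- s) (A k j 0 <= p j <= B k j 0)%R%:R)%:E)%E.
  apply: le_trans (le_trans Kgr _); first by rewrite lee_fin.
  apply: lee_wpmul2l; first by rewrite lee_fin ltW.
  apply: le_trans (measure_sigma_subadditive _ _ _ _) _.
  - by move=> k; exact: mJ.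
  - by apply: bigcup_measurable => k _; exact: mJ.
  - by [].
  by rewrite le_eqVlt; apply/orP; left; apply/eqP; apply: eq_eseriesr => k _; exact: muJ.
have -> : (G / 2)%:E = (K%:E * c%:E)%E.
  by rewrite -EFinM /c; congr _%:E; field; rewrite gt_eqF.
by rewrite lee_pmul2l// lte_fin.
Qed.

(** The upper bound of [segment_growth] is applied to [h] and to [- h]; a negative step is a
    positive one with the endpoints exchanged. *)
Lemma coord_step (R : realType) (n : nat) (h : 'cV[R]_n -> R)
    (U D : set 'cV[R]_n) (x c : 'cV[R]_n) (r L eta : R) :
  lebesgue_outer (U `\` D) = 0%E ->
  (forall y, `|y - x| < r -> U y) -> 0 < L ->
  (forall y z, U y -> U z -> `|h y - h z| <= L * `|y - z|) ->
  (forall y i, D y -> `|y - x| < r -> derivable h y (delta_mx i 0) /\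
    `|'D_(delta_mx i 0) h y - c i 0| <= eta) ->
  forall z s i, `|z - x| < r -> `|z + s *: delta_mx i 0 - x| < r ->
  `|h (z + s *: delta_mx i 0) - h z - c i 0 * s| <= eta * `|s|.
Proof.
move=> UD0 rU L0 hL hD.
have pos z s i : 0 < s -> `|z - x| < r -> `|z + s *: delta_mx i 0 - x| < r ->
    `|h (z + s *: delta_mx i 0) - h z - c i 0 * s| <= eta * s.
  move=> s0 zr zsr.
  have h1 : h (z + s *: delta_mx i 0) - h z <= (c i 0 + eta) * s.
    apply: (segment_growth UD0 rU L0) => //.
      by move=> y y' Uy Uy'; apply: le_trans (ler_norm _) (hL _ _ Uy Uy').
    move=> y Dy yr; have [der] := hD y i Dy yr.
    by rewrite ler_norml => /andP[_ Dle]; split=> //; lra.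
  have h2 : (- h) (z + s *: delta_mx i 0) - (- h) z <= (- c i 0 + eta) * s.
    apply: (segment_growth UD0 rU L0) => //.
      move=> y y' Uy Uy'; rewrite distrC.
      apply: le_trans (hL _ _ Uy' Uy); apply: le_trans (ler_norm _).
      by rewrite /= opprK addrC.
    move=> y Dy yr; have [der] := hD y i Dy yr.
    rewrite ler_norml => /andP[Dle _]; split; first exact: derivableN.
    by rewrite deriveN//; lra.
  have h3 : - h (z + s *: delta_mx i 0) + h z <= (- c i 0 + eta) * s.
    by move: h2; rewrite /= opprK.
  by rewrite ler_norml; apply/andP; split; lra.
move=> z s i zr zsr; have [s0|s0|<-] := ltgtP 0 s.
- by rewrite (gtr0_norm s0); exact: pos.
- have E : z + s *: delta_mx i 0 + - s *: delta_mx i 0 = z by rewrite scaleNr addrK.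
  have := pos (z + s *: delta_mx i 0) (- s) i.
  rewrite E oppr_gt0 => /(_ s0 zsr zr).
  rewrite (ltr0_norm s0) => H; rewrite -normrN; apply: le_trans H.
  by rewrite le_eqVlt; apply/orP; left; apply/eqP; congr `|_|; ring.
- by rewrite scale0r addr0 subrr mulr0 subrr !normr0 mulr0.
Qed.

(** Walk from [x] to [y] replacing one coordinate at a time. The intermediate points stay in the
    ball because it is a cube for the sup norm, and each of the [n] steps costs at most [eta] times
    the distance. *)
Lemma cube_linear_bound (R : realType) (n : nat) (h : 'cV[R]_n -> R)
    (U D : set 'cV[R]_n) (x c : 'cV[R]_n) (r L eta : R) :
  lebesgue_outer (U `\` D) = 0%E ->
  (forall y, `|y - x| < r -> U y) -> 0 < L -> 0 <= eta ->
  (forall y z, U y -> U z -> `|h y - h z| <= L * `|y - z|) ->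
  (forall y i, D y -> `|y - x| < r -> derivable h y (delta_mx i 0) /\
    `|'D_(delta_mx i 0) h y - c i 0| <= eta) ->
  forall y, `|y - x| < r ->
  `|h y - h x - dot c (y - x)| <= n%:R * eta * `|y - x|.
Proof.
move=> UD0 rU L0 eta0 hL hD y yr.
pose pt m : 'cV[R]_n := \col_j (if (j < m)%N then y j 0 else x j 0).
have ptr m : `|pt m - x| < r.
  apply: le_lt_trans yr; apply: ler_norm_coord => // j.
  rewrite !mxE; case: ifP => _; last by rewrite subrr normr0.
  by have := ler_coord_norm (y - x) j; rewrite !mxE.
have step (i : 'I_n) : pt i.+1 = pt i + (y i 0 - x i 0) *: delta_mx i 0.
  apply/colP => j; rewrite !mxE eqxx andbT ltnS leq_eqVlt.
  have [->|ji] := eqVneq j i; first by rewrite eqxx ltnn/= mulr1 addrC subrK.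
  by rewrite (inj_eq val_inj) (negbTE ji) mulr0 addr0.
have ptn : pt n = y by apply/colP => j; rewrite mxE ltn_ord.
have pt0 : pt 0 = x by apply/colP => j; rewrite mxE.
suff H m : (m <= n)%N ->
    `|h (pt m) - h x - dot c (pt m - x)| <= m%:R * eta * `|y - x|.
  by have := H n (leqnn _); rewrite ptn.
elim: m => [_|m IH mn]; first by rewrite pt0 !subrr dot0r !mul0r subrr normr0.
have {}IH := IH (ltnW mn).
have E := step (Ordinal mn); rewrite /= in E.
set s := _ - _ in E; set e := delta_mx _ _ in E.
have h1 : `|h (pt m + s *: e) - h (pt m) - c (Ordinal mn) 0 * s| <= eta * `|s|.
  by apply: (coord_step UD0 rU L0 hL hD); rewrite ?ptr// -/e -E ptr.
have s1 : `|s| <= `|y - x|.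
  by have := ler_coord_norm (y - x) (Ordinal mn); rewrite !mxE.
have dotE1 : dot c (pt m.+1 - x) = dot c (pt m - x) + c (Ordinal mn) 0 * s.
  rewrite E addrAC [LHS]dotDr dotZr; congr (_ + _); rewrite mulrC; congr (_ * _).
  rewrite /dot (bigD1 (Ordinal mn))//= big1 ?addr0; last first.
    by move=> j ji; rewrite !mxE (negbTE ji) mulr0.
  by rewrite !mxE !eqxx mulr1.
rewrite dotE1 E -natr1 !mulrDl mul1r.
have -> : h (pt m + s *: e) - h x - (dot c (pt m - x) + c (Ordinal mn) 0 * s) =
  (h (pt m) - h x - dot c (pt m - x)) +
  (h (pt m + s *: e) - h (pt m) - c (Ordinal mn) 0 * s) by ring.
apply: le_trans (ler_normD _ _) (lerD IH _).
by apply: (le_trans h1); rewrite ler_wpM2l.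
Qed.

(** On a ball around [x] whose radius is a small fraction of [m], the distance from [x] to [xbar],
    every available gradient is within a small multiple of [m] of [g + A *m (x - xbar)].
    [cube_linear_bound] turns this into an estimate at all points of the ball. *)
Lemma local_linear_bound (R : realType) (n : nat) (h : 'cV[R]_n -> R)
    (U D : set 'cV[R]_n) (xbar g : 'cV[R]_n) (A : 'M[R]_n) (L : R) :
  nbhs xbar U -> lebesgue_outer (U `\` D) = 0%E ->
  (forall y z, U y -> U z -> `|h y - h z| <= L * enorm (y - z)) ->
  (forall y i, D y -> derivable h y (delta_mx i 0)) ->
  (forall e, 0 < e -> exists2 d, 0 < d & forall y i, D y -> 0 < `|y - xbar| ->
    `|y - xbar| < d ->
    `|'D_(delta_mx i 0) h y - g i 0 - (A *m (y - xbar)) i 0| <= e * `|y - xbar|) ->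
  forall e, 0 < e -> exists2 d, 0 < d &
    forall x, 0 < `|x - xbar| -> `|x - xbar| < d -> \forall y \near x,
      `|h y - h x - dot (g + A *m (x - xbar)) (y - x)| <=
        e * `|x - xbar| * `|y - x|.
Proof.
move=> /nbhs_ballP[d2 /= d20 dU] UD0 hL hder hD e e0.
have {}dU y : `|y - xbar| < d2 -> U y.
  by move=> yd; apply: dU; rewrite -ball_normE/= distrC.
pose L' := n%:R * `|L| + 1.
have L'0 : 0 < L' by rewrite ltr_wpDl ?mulr_ge0 ?ler0n.
have hL' y z : U y -> U z -> `|h y - h z| <= L' * `|y - z|.
  move=> Uy Uz; apply: (le_trans (hL y z Uy Uz)).
  apply: (@le_trans _ _ (`|L| * enorm (y - z))).
    by rewrite ler_wpM2r ?enorm_ge0// ler_norm.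
  rewrite /L' mulrDl mul1r [n%:R * _]mulrC -mulrA ler_wpDr//.
  by rewrite ler_wpM2l// ler_enorm_norm.
have n1 : 0 < n.+1%:R :> R by rewrite ltr0Sn.
(* The gradients will deviate by at most [2 * e1 * m], and [cube_linear_bound] multiplies this by
   [n]. *)
pose e1 := e / (2 * n.+1%:R).
have e10 : 0 < e1 by rewrite divr_gt0 ?mulr_gt0.
have [d1 d10 hd] := hD e1 e10.
have [K K0 AK] := ler_mulmx_enorm A.
pose K' := K * n%:R + e1.
have K'0 : 0 < K' by rewrite ltr_wpDl ?mulr_ge0 ?ler0n// ltW.
pose d := Num.min d1 d2 / 2.
have d0 : 0 < d by rewrite divr_gt0// lt_min d10.
have dd1 : 2 * d <= d1 by rewrite /d mulrC divfK// ge_min lexx.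
have dd2 : 2 * d <= d2 by rewrite /d mulrC divfK// ge_min lexx orbT.
exists d => // x x0 xd.
set m := `|x - xbar| in x0 xd *.
(* The first bound keeps the ball away from [xbar], where the gradient estimate says nothing. The
   second makes the variation of [A] plus the expansion error, at most [K * n * r + e1 * (m + r)],
   no larger than [2 * e1 * m]. *)
pose r := Num.min (m / 2) (e1 * m / K').
have r0 : 0 < r by rewrite lt_min !divr_gt0// mulr_gt0.
have rm : r <= m / 2 by rewrite /r ge_min lexx.
have rK : K' * r <= e1 * m.
  by rewrite mulrC -ler_pdivlMr// /r ge_min lexx orbT.
have near_y y : `|y - x| < r -> `|y - xbar| < m + r /\ 0 < `|y - xbar|.
  move=> yr; have -> : y - xbar = (y - x) + (x - xbar) by rewrite addrA subrK.
  split; first by apply: le_lt_trans (ler_normD _ _) _; rewrite addrC ltrD2l.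
  have := lerB_normD (x - xbar) (y - x).
  by rewrite [(x - xbar) + _]addrC -/m; lra.
have rU y : `|y - x| < r -> U y.
  by move=> /near_y[yr _]; apply: dU; lra.
have eta0 : 0 <= 2 * e1 * m by rewrite !mulr_ge0// ltW.
apply/nbhs_ballP; exists r => //= y; rewrite -ball_normE/= distrC => yr.
have := @cube_linear_bound _ _ h U D x (g + A *m (x - xbar)) r L' (2 * e1 * m)
  UD0 rU L'0 eta0 hL' _ y yr.
move=> H; apply: (le_trans (H _)).
  move=> {H yr}y i Dy yr; split; first exact: hder.
  have [y1 y0] := near_y y yr.
  have y1' : `|y - xbar| < d1 by lra.
  have h1 := hd y i Dy y0 y1'.
  have -> : 'D_(delta_mx i 0) h y - (g + A *m (x - xbar)) i 0 =
    ('D_(delta_mx i 0) h y - g i 0 - (A *m (y - xbar)) i 0) + (A *m (y - x)) i 0.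
    by rewrite !mulmxBr !mxE; ring.
  apply: le_trans (ler_normD _ _) _.
  have h2 : `|(A *m (y - x)) i 0| <= K * n%:R * `|y - x|.
    apply: le_trans (ler_coord_norm _ _) _; apply: le_trans (ler_norm_enorm _) _.
    apply: (le_trans (AK _)); rewrite -mulrA ler_pM2l//; exact: ler_enorm_norm.
  have h3 : K * n%:R * `|y - x| <= K * n%:R * r.
    by apply: ler_wpM2l; [rewrite mulr_ge0 ?ler0n// ltW|exact: ltW].
  have h4 : e1 * `|y - xbar| <= e1 * (m + r) by rewrite ler_pM2l// ltW.
  by move: rK; rewrite /K'; lra.
rewrite ler_wpM2r//.
have -> : n%:R * (2 * e1 * m) = n%:R / n.+1%:R * (e * m).
  by rewrite /e1; field; rewrite gt_eqF.
by rewrite ger_pMl ?mulr_gt0// ler_pdivrMr// mul1r ler_nat.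
Qed.

(** Along the segment from [xbar], the linear terms of [h] and of its quadratic model cancel at each
    time t > 0, leaving a right slope of at most [e] times the squared length. Time 0 is excluded
    because the first-order estimate is centred only at points other than [xbar]; hence the
    exceptional set [[set 0]] in [lipschitz_ae_growth]. *)
Lemma taylor_upper (R : realType) (n : nat) (h : 'cV[R]_n -> R)
    (xbar g : 'cV[R]_n) (A : 'M[R]_n) (L : R) :
  (\forall y \near xbar & z \near xbar, `|h y - h z| <= L * enorm (y - z)) ->
  (forall e, 0 < e -> exists2 d, 0 < d &
    forall x, 0 < `|x - xbar| -> `|x - xbar| < d -> \forall y \near x,
      h y - h x - dot (g + A *m (x - xbar)) (y - x) <=
        e * `|x - xbar| * `|y - x|) ->
  forall e, 0 < e -> \forall x \near xbar,
    h x - h xbar - quad g A (x - xbar) <= e * `|x - xbar| ^+ 2.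
Proof.
move=> [[U1 U2] /= [/nbhs_ballP[r1 /= r10 rU1] /nbhs_ballP[r2 /= r20 rU2]] hL] H e e0.
have [d d0 hd] := H e e0.
pose r := Num.min d (Num.min r1 r2).
have r0 : 0 < r by rewrite !lt_min d0 r10.
apply/nbhs_ballP; exists r => //= x; rewrite -ball_normE/= distrC => xr.
pose v := x - xbar; rewrite -/v in xr *.
have [v0|v0] := eqVneq v 0.
  have -> : x = xbar by apply/eqP; rewrite -subr_eq0 -/v v0.
  by rewrite v0 subrr /quad dot0r mulmx0 dot0r mulr0 addr0 subr0 mulr_ge0 ?sqr_ge0// ltW.
have {}v0 : 0 < `|v| by rewrite normr_gt0.
have [vd [vr1 vr2]] : `|v| < d /\ `|v| < r1 /\ `|v| < r2.
  by move: xr; rewrite !lt_min => /and3P[].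
pose q := dot (A *m v) v; pose p := dot g v.
pose s t := h (xbar + t *: v) - t * p - 2^-1 * t ^+ 2 * q.
pose C := `|L| * enorm v + `|p| + `|q| + 1.
have C0 : 0 < C.
  by rewrite ltr_wpDl// addr_ge0// addr_ge0// mulr_ge0 ?enorm_ge0.
have seg t : 0 <= t -> t <= 1 -> `|t *: v| <= `|v|.
  by move=> t0 t1; rewrite normrZ ger0_norm// ler_piMl.
have := @lipschitz_ae_growth R s 1 C (e * `|v| ^+ 2) [set 0] ltr01 C0.
rewrite lebesgue_measure_set1 mule0 lee_fin => main.
suff : s 1 - s 0 - e * `|v| ^+ 2 * 1 <= 0.
  have xv : xbar + v = x by rewrite addrC subrK.
  rewrite /s scale1r scale0r addr0 xv /quad -/p -/q.
  by rewrite !mul0r expr1n expr0n/= !mulr0 !mul0r !subr0 mulr1 mul1r; lra.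
apply: main => //.
- move=> t u t0 t1 u0 u1; rewrite /s.
  have h1 : `|h (xbar + u *: v) - h (xbar + t *: v)| <= `|L| * enorm v * `|u - t|.
    apply: (le_trans (hL (_, _) _)) => /=.
      split=> /=; [apply: rU1|apply: rU2]; rewrite -ball_normE/= opprD addrA subrr
        add0r normrN.
        exact: le_lt_trans (seg _ u0 u1) vr1.
      exact: le_lt_trans (seg _ t0 t1) vr2.
    rewrite opprD addrACA subrr add0r -scalerBl enormZ mulrCA mulrC.
    by rewrite ler_wpM2r// ler_wpM2r ?enorm_ge0// ler_norm.
  have h2 : - (u - t) * p <= `|p| * `|u - t|.
    by apply: le_trans (ler_norm _) _; rewrite normrM normrN mulrC.
  have h3 : - (2^-1 * (u ^+ 2 - t ^+ 2) * q) <= `|q| * `|u - t|.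
    apply: le_trans (ler_norm _) _; rewrite normrN mulrC normrM ler_wpM2l//.
    have -> : 2^-1 * (u ^+ 2 - t ^+ 2) = ((u + t) / 2) * (u - t) by field.
    rewrite normrM ler_piMl// ger0_norm; lra.
  have h4 := le_trans (ler_norm _) h1.
  have h5 : 0 <= `|u - t| by [].
  by rewrite /C !mulrDl mul1r; lra.
- move=> t t0 t1 tn0 a a0.
  have {}t0 : 0 < t by rewrite lt_def t0 andbT; apply/eqP.
  have xE : xbar + t *: v - xbar = t *: v by rewrite addrC addKr.
  have tv0 : 0 < `|xbar + t *: v - xbar|.
    by rewrite xE normrZ mulr_gt0// normr_gt0 gt_eqF.
  have tvd : `|xbar + t *: v - xbar| < d.
    by rewrite xE; apply: le_lt_trans (seg _ (ltW t0) (ltW t1)) vd.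
  have /nbhs_ballP[b /= b0 hb] := hd _ tv0 tvd.
  (* The first bound stays where the first-order estimate around time [t] holds; the second keeps
     the second-order term in [u - t] of the model below [a * (u - t)]. *)
  pose b1 := Num.min (b / (`|v| + 1)) (a / (`|q| + 1)).
  have b10 : 0 < b1 by rewrite lt_min !divr_gt0// ltr_wpDl.
  exists b1 => // u tu ub u1.
  have yE : xbar + u *: v - (xbar + t *: v) = (u - t) *: v.
    by rewrite opprD addrACA subrr add0r -scalerBl.
  have ut0 : 0 <= u - t by rewrite subr_ge0.
  have utv : (u - t) * (`|v| + 1) < b.
    rewrite -ltr_pdivlMr ?ltr_wpDl//.
    by apply: (@lt_le_trans _ _ b1); [lra|rewrite /b1 ge_min lexx].
  have utq : (u - t) * (`|q| + 1) < a.
    rewrite -ltr_pdivlMr ?ltr_wpDl//.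
    by apply: (@lt_le_trans _ _ b1); [lra|rewrite /b1 ge_min lexx orbT].
  have := hb (xbar + u *: v).
  rewrite -ball_normE/= distrC yE xE !normrZ (ger0_norm ut0) (gtr0_norm t0).
  have -> : (u - t) * `|v| < b by lra.
  move=> /(_ isT); rewrite dotZr dotDl -scalemxAr dotZl -/p -/q => h1.
  have h2 : - q * (u - t) <= `|q| * (u - t).
    by apply: ler_wpM2r => //; apply: le_trans (ler_norm _) _; rewrite normrN.
  have h3 : 0 <= (u - t) * (a - 2^-1 * (u - t) * - q).
    by apply: mulr_ge0 => //; lra.
  have h4 : 0 <= (1 - t) * (e * `|v| ^+ 2 * (u - t)).
    by rewrite !mulr_ge0 ?sqr_ge0 ?(ltW e0)// subr_ge0 ltW.
  by rewrite /s; nra.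
Qed.

Lemma taylor_expansion (R : realType) (n : nat) (h : 'cV[R]_n -> R)
    (xbar g : 'cV[R]_n) (A : 'M[R]_n) (L : R) :
  (\forall y \near xbar & z \near xbar, `|h y - h z| <= L * enorm (y - z)) ->
  (forall e, 0 < e -> exists2 d, 0 < d &
    forall x, 0 < `|x - xbar| -> `|x - xbar| < d -> \forall y \near x,
      `|h y - h x - dot (g + A *m (x - xbar)) (y - x)| <=
        e * `|x - xbar| * `|y - x|) ->
  forall e, 0 < e -> \forall x \near xbar,
    `|h x - h xbar - quad g A (x - xbar)| <= e * `|x - xbar| ^+ 2.
Proof.
move=> hL H e e0.
have Nh z : (- h) z = - h z by [].
have hL' : \forall y \near xbar & z \near xbar, `|(- h) y - (- h) z| <= L * enorm (y - z).
  by apply: filterS hL => -[y z] /= h1; rewrite -opprD normrN.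
have h1 := taylor_upper hL _ e0; have h2 := taylor_upper hL' _ e0.
have up : \forall x \near xbar, h x - h xbar - quad g A (x - xbar) <= e * `|x - xbar| ^+ 2.
  apply: h1 => a a0; have [d d0 hd] := H a a0; exists d => // x x0 xd.
  by apply: filterS (hd x x0 xd) => y; apply: le_trans; exact: ler_norm.
have lo : \forall x \near xbar,
    (- h) x - (- h) xbar - quad (- g) (- A) (x - xbar) <= e * `|x - xbar| ^+ 2.
  apply: h2 => a a0; have [d d0 hd] := H a a0; exists d => // x x0 xd.
  apply: filterS (hd x x0 xd) => y; apply: le_trans.
  have -> : - g + - A *m (x - xbar) = - (g + A *m (x - xbar)) by rewrite mulNmx opprD.
  rewrite dotNl opprK -normrN.
  apply: le_trans (ler_norm _); rewrite le_eqVlt; apply/orP; left; apply/eqP.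
  by rewrite !Nh; ring.
near=> x; rewrite ler_norml; apply/andP; split; last by near: x.
have : (- h) x - (- h) xbar - quad (- g) (- A) (x - xbar) <= e * `|x - xbar| ^+ 2.
  by near: x.
by rewrite /quad mulNmx !dotNl !Nh; lra.
Unshelve. all: by end_near. Qed.

(** * Second subderivatives *)

(** From here on the null set and [D] no longer appear. The definition divides by the Euclidean norm
    while the mean value estimates use the sup norm, which is why its limit is tested with
    [e / n.+1]. *)
Lemma ext_hessian_expansion (R : realType) (n : nat) (phi : 'cV[R]_n -> \bar R)
    (xbar : 'cV[R]_n) (A : 'M[R]_n) : is_ext_hessian phi xbar A ->
  [/\ exists2 L : R, 0 < L & \forall y \near xbar & z \near xbar,
        `|fine (phi y) - fine (phi z)| <= L * enorm (y - z),
    forall e, 0 < e -> exists2 d, 0 < d &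
      forall x, 0 < enorm (x - xbar) -> enorm (x - xbar) < d -> \forall y \near x,
        `|fine (phi y) - fine (phi x) -
          dot (gradient phi xbar + A *m (x - xbar)) (y - x)| <=
          e * enorm (x - xbar) * enorm (y - x) &
    forall e, 0 < e -> \forall x \near xbar,
      `|fine (phi x) - fine (phi xbar) - quad (gradient phi xbar) A (x - xbar)| <=
        e * enorm (x - xbar) ^+ 2].
Proof.
move=> [_ [U [D [[nU DU] UD0 [_ [L hL]] Ddiff lim]]]].
have Lip : \forall y \near xbar & z \near xbar,
    `|fine (phi y) - fine (phi z)| <= L * enorm (y - z).
  by exists (U, U) => // -[y z] [/= Uy Uz]; exact: hL.
have der y i : D y -> derivable (fine \o phi) y (delta_mx i 0).
  by move=> /Ddiff[_ /diff_derivable]; apply.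
have grad e : 0 < e -> exists2 d, 0 < d & forall y i, D y -> 0 < `|y - xbar| ->
    `|y - xbar| < d ->
    `|'D_(delta_mx i 0) (fine \o phi) y - gradient phi xbar i 0 -
      (A *m (y - xbar)) i 0| <= e * `|y - xbar|.
  move=> e0; have e'0 : 0 < e / n.+1%:R by rewrite divr_gt0.
  have /lim : nbhs (0 : 'cV[R]_n) [set z | `|z| < e / n.+1%:R].
    apply/nbhs_ballP; exists (e / n.+1%:R) => //= z.
    by rewrite -ball_normE/= sub0r normrN.
  rewrite /= => /nbhs_ballP[d /= d0 hd]; exists d => // y i Dy y0 yd.
  have yx : y != xbar by rewrite -subr_eq0 -normr_gt0.
  have := hd y; rewrite -ball_normE/= distrC => /(_ yd yx Dy).
  set z := gradient phi y - _ - _.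
  have ey0 : 0 < enorm (y - xbar) by rewrite enorm_gt0 subr_eq0.
  rewrite normrZ gtr0_norm ?invr_gt0// mulrC ltr_pdivrMr// => zlt.
  have := ler_coord_norm z i; rewrite !mxE => /le_trans; apply.
  apply: (le_trans (ltW zlt)).
  have := ler_enorm_norm (y - xbar).
  rewrite -(ler_pM2l e'0) => /le_trans; apply.
  rewrite mulrA ler_wpM2r// -mulrA ger_pMr// mulrC ler_pdivrMr// mul1r ler_nat//.
have lin := local_linear_bound nU UD0 hL der grad.
have tay := taylor_expansion Lip lin.
split.
- exists (`|L| + 1); first by rewrite ltr_wpDl.
  apply: filterS Lip => -[y z] /= h; apply: (le_trans h).
  by rewrite ler_wpM2r ?enorm_ge0//; have := ler_norm L; lra.
- move=> e e0; have [d d0 hd] := lin e e0; exists d => // x x0 xd.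
  have x0' : 0 < `|x - xbar| by rewrite normr_gt0 -enorm_gt0.
  apply: filterS (hd x x0' (le_lt_trans (ler_norm_enorm _) xd)) => y /le_trans; apply.
  rewrite ler_pM ?mulr_ge0 ?ler_norm_enorm ?(ltW e0)//.
  by rewrite ler_pM2l// ler_norm_enorm.
- move=> e e0; apply: filterS (tay e e0) => x /le_trans; apply.
  by rewrite ler_pM2l// ler_sqr ?nnegrE ?enorm_ge0// ler_norm_enorm.
Qed.

(** * Difference quotients, homogeneity and growth *)

Lemma second_subderiv_gt (R : realType) (n : nat) (F : 'cV[R]_n -> \bar R)
    (xbar v w : 'cV[R]_n) (c : \bar R) : (c < second_subderiv F xbar v w)%E ->
  exists2 d : R, 0 < d & forall t w', 0 < t -> t < d -> enorm (w' - w) < d ->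
    (c < second_diff_quot F xbar v t w')%E.
Proof.
move=> /limf_einf_gt[[T W] /= [/nbhs_ballP[d1 /= d10 hT] /nbhs_enormP[d2 d20 hW]] H].
exists (Num.min d1 d2); first by rewrite lt_min d10.
move=> t w' t0; rewrite !lt_min => /andP[td1 _] /andP[_ wd2].
apply: (H (t, w')); split => /=; last exact: hW.
by apply: hT => //; rewrite /ball/= sub0r normrN gtr0_norm.
Qed.

Lemma second_subderiv_lt (R : realType) (n : nat) (F : 'cV[R]_n -> \bar R)
    (xbar v w : 'cV[R]_n) (c : \bar R) : (second_subderiv F xbar v w < c)%E ->
  forall d : R, 0 < d -> exists t w', [/\ 0 < t, t < d, enorm (w' - w) < d &
    (second_diff_quot F xbar v t w' < c)%E].
Proof.
move=> h d d0.
have [|[t w'] [/= t0 td] H] := @limf_einf_lt _ _ _ _ _ _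
  [set p : R * 'cV[R]_n | (0 < p.1 /\ p.1 < d) /\ enorm (p.2 - w) < d] h.
  exists ([set t : R | 0 < t /\ t < d], [set w' | enorm (w' - w) < d]) => //=.
  split; last exact: enorm_near.
  apply/nbhs_ballP; exists d => //= t; rewrite /ball/= sub0r normrN => td t0.
  by split=> //; apply: le_lt_trans td; exact: ler_norm.
by exists t, w'; case: t0.
Qed.

Lemma second_subderiv_ge (R : realType) (n : nat) (F : 'cV[R]_n -> \bar R)
    (xbar v w : 'cV[R]_n) (c : R) :
  (forall e : R, 0 < e -> exists2 d : R, 0 < d & forall t w', 0 < t -> t < d ->
    enorm (w' - w) < d -> ((c - e)%:E <= second_diff_quot F xbar v t w')%E) ->
  (c%:E <= second_subderiv F xbar v w)%E.
Proof.
move=> h; apply: limf_einf_ge => e e0; have [d d0 hd] := h e e0.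
exists ([set t : R | 0 < t /\ t < d], [set w' | enorm (w' - w) < d]) => /=.
  split; last exact: enorm_near.
  apply/nbhs_ballP; exists d => //= t; rewrite /ball/= sub0r normrN => td t0.
  by split=> //; apply: le_lt_trans td; exact: ler_norm.
by move=> [t w'] /= [[t0 td] wd]; exact: hd.
Qed.

Lemma lee_dense_EFin (R : realType) (x y : \bar R) :
  (forall c : R, (c%:E < x)%E -> (c%:E <= y)%E) -> (x <= y)%E.
Proof.
move=> h; rewrite leNgt; apply/negP => /lte_dense_EFin[a ya ax].
by have := h a ax; rewrite leNgt ya.
Qed.

Lemma second_subderiv_shift (R : realType) (n : nat) (F G : 'cV[R]_n -> \bar R)
    (xbar v v' w : 'cV[R]_n) (a : R) :
  (forall e : R, 0 < e -> exists2 d : R, 0 < d & forall t w', 0 < t -> t < d ->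
    enorm (w' - w) < d -> (second_diff_quot F xbar v t w' + (a - e)%:E <=
      second_diff_quot G xbar v' t w')%E) ->
  (a%:E + second_subderiv F xbar v w <= second_subderiv G xbar v' w)%E.
Proof.
move=> h; apply: lee_dense_EFin => c.
rewrite addeC -lteBlDr// -EFinB => /second_subderiv_gt[d d0 hd].
apply: second_subderiv_ge => e e0; have [d' d'0 hd'] := h e e0.
exists (Num.min d d'); first by rewrite lt_min d0.
move=> t w' t0; rewrite !lt_min => /andP[td td'] /andP[wd wd'].
apply: le_trans (hd' t w' t0 td' wd').
have /ltW hc := hd t w' t0 td wd.
by rewrite -leeBlDr// -EFinB; apply: le_trans hc; rewrite lee_fin; lra.
Qed.

Lemma second_diff_quotZ (R : realType) (n : nat) (F : 'cV[R]_n -> \bar R)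
    (xbar v w : 'cV[R]_n) (t lam : R) : 0 < lam -> 0 < t ->
  second_diff_quot F xbar v t (lam *: w) =
    ((lam ^+ 2)%:E * second_diff_quot F xbar v (lam * t) w)%E.
Proof.
move=> lam0 t0; rewrite /second_diff_quot muleCA -EFinM scalerA [t * lam]mulrC.
rewrite dotZr mulrCA mulrA; congr (_ * _%:E)%E.
by field; rewrite !gt_eqF.
Qed.

Lemma second_subderivZ_ge (R : realType) (n : nat) (F : 'cV[R]_n -> \bar R)
    (xbar v w : 'cV[R]_n) (c lam : R) : 0 < lam ->
  (c%:E <= second_subderiv F xbar v w)%E ->
  ((lam ^+ 2 * c)%:E <= second_subderiv F xbar v (lam *: w))%E.
Proof.
move=> lam0 h; apply: second_subderiv_ge => e e0.
have lam2 : 0 < lam ^+ 2 by rewrite exprn_gt0.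
have [|d d0 hd] := @second_subderiv_gt _ _ F xbar v w (c - e / lam ^+ 2)%:E.
  by apply: lt_le_trans h; rewrite lte_fin ltrBlDr ltrDl divr_gt0.
exists (Num.min (d / lam) (d * lam)); first by rewrite lt_min divr_gt0 ?mulr_gt0.
move=> t z t0; rewrite !lt_min => /andP[td _] /andP[_ zd].
have -> : z = lam *: (lam^-1 *: z) by rewrite scalerA divff ?scale1r// gt_eqF.
rewrite second_diff_quotZ//.
have -> : ((lam ^+ 2 * c - e)%:E = (lam ^+ 2)%:E * (c - e / lam ^+ 2)%:E)%E.
  by rewrite -EFinM; congr _%:E; field; rewrite gt_eqF.
rewrite lee_pmul2l ?lte_fin//; apply/ltW/hd.
- by rewrite mulr_gt0.
- by rewrite mulrC -ltr_pdivlMr.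
have -> : lam^-1 *: z - w = lam^-1 *: (z - lam *: w).
  by rewrite scalerBr scalerA mulVf ?scale1r// gt_eqF.
by rewrite enormZ gtr0_norm ?invr_gt0// mulrC ltr_pdivrMr.
Qed.

(** Compactness of the sphere against the filter of intervals []0, d[]: a threshold found direction
    by direction becomes a common one. *)
Lemma sphere_uniform (R : realType) (n : nat) (x0 : 'cV[R]_n) (rho : R)
    (P : R -> 'cV[R]_n -> Prop) :
  (forall w, enorm (w - x0) = rho -> exists2 d, 0 < d &
    forall t w', 0 < t -> t < d -> enorm (w' - w) < d -> P t w') ->
  exists2 d, 0 < d & forall t, 0 < t -> t < d ->
    forall w, enorm (w - x0) = rho -> P t w.
Proof.
move=> h; have /compact_near_coveringP K := @compact_sphere _ _ x0 rho.
have FF : Filter (filter_from [set d : R | 0 < d]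
    (fun d => [set t | 0 < t /\ t < d])).
  apply: filter_from_filter; first by exists 1 => /=; exact: ltr01.
  move=> a b /= a0 b0; exists (Num.min a b); first by rewrite /= lt_min a0.
  by move=> t /= [t0]; rewrite lt_min => /andP[ta tb].
have [w /h[d d0 hd]|d /= d0 hd] := K R _ P FF.
  exists ([set w' | enorm (w' - w) < d], [set t | 0 < t /\ t < d]) => /=.
    by split; [exact: enorm_near|exists d].
  by move=> [w' t] /= [wd [t0 td]]; exact: hd.
by exists d => // t t0 td w; exact: (hd t (conj t0 td)).
Qed.

Lemma growth_second_subderiv (R : realType) (n : nat) (f : 'cV[R]_n -> \bar R)
    (xbar w : 'cV[R]_n) (kappa gamma : R) : 0 < gamma ->
  growth_on_ball f xbar kappa gamma ->
  ((kappa * enorm w ^+ 2)%:E <= second_subderiv f xbar 0 w)%E.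
Proof.
move=> g0 gr; apply: second_subderiv_ge => e e0.
have : \forall z \near w, kappa * enorm w ^+ 2 - e < kappa * enorm z ^+ 2.
  apply: (@cvgr_gt R _ (nbhs w) _ (fun z => kappa * enorm z ^+ 2)
    (kappa * enorm w ^+ 2)); last by rewrite ltrBlDr ltrDl.
  apply: cvgM; first exact: cvg_cst.
  by apply: cvgM; apply: cvg_enorm; exact: cvg_id.
move=> /nbhs_enormP[d d0 hd].
have w1 : 0 < enorm w + d by rewrite ltr_wpDl ?enorm_ge0.
exists (Num.min d (gamma / (enorm w + d))); first by rewrite lt_min d0 divr_gt0.
move=> t z t0; rewrite !lt_min => /andP[_ tg] /andP[zd _].
have zw : enorm z < enorm w + d.
  rewrite -[z](subrK w) addrC; apply: le_lt_trans (ler_enormD _ _) _.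
  by rewrite ltrD2l.
have xE : enorm (xbar + t *: z - xbar) = t * enorm z.
  by rewrite addrC addKr enormZ gtr0_norm.
have tzg : t * enorm z <= gamma.
  rewrite ltr_pdivlMr// in tg; apply: ltW; apply: le_lt_trans tg.
  by rewrite ler_pM2l// ltW.
have := gr (xbar + t *: z); rewrite /cball/= xE => /(_ tzg) h.
have T0 : 0 < 2^-1 * t ^+ 2 by rewrite mulr_gt0 ?exprn_gt0.
rewrite /second_diff_quot dot0l mulr0 sube0 lee_pdivlMr//.
apply: le_trans h; rewrite -EFinM lee_fin.
have -> : kappa / 2 * (t * enorm z) ^+ 2 =
  kappa * enorm z ^+ 2 * (2^-1 * t ^+ 2) by field.
by rewrite ler_pM2r// ltW// hd.
Qed.

(** With [t] the distance from [x] to [xbar] and a unit direction, growth at [x] is a bound on the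
    difference quotient. The strict inequality is what a lower limit passes on to all nearby [t] and
    directions. *)
Lemma second_subderiv_growth (R : realType) (n : nat) (f : 'cV[R]_n -> \bar R)
    (xbar : 'cV[R]_n) (kappa : R) : f xbar \is a fin_num ->
  (forall w, enorm w = 1 -> (kappa%:E < second_subderiv f xbar 0 w)%E) ->
  exists2 gamma, 0 < gamma & growth_on_ball f xbar kappa gamma.
Proof.
move=> fx h.
have [|d d0 hd] := @sphere_uniform R n 0 1
    (fun t w => (kappa%:E < second_diff_quot f xbar 0 t w)%E).
  by move=> w; rewrite subr0 => /h; exact: second_subderiv_gt.
exists (d / 2); first exact: divr_gt0.
move=> x xd; have [->|x0] := eqVneq x xbar.
  by rewrite subrr enorm0 expr0n mulr0 subee.
set t := enorm (x - xbar).
have t0 : 0 < t by rewrite enorm_gt0 subr_eq0.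
have td : t < d by apply: le_lt_trans xd _; lra.
have w1 : enorm (t^-1 *: (x - xbar) - 0) = 1.
  by rewrite subr0 enormZ gtr0_norm ?invr_gt0// mulVf// gt_eqF.
have := hd t t0 td _ w1.
rewrite /second_diff_quot dot0l mulr0 sube0 scalerA divff ?gt_eqF// scale1r.
rewrite [xbar + _]addrC subrK lte_pdivlMr ?mulr_gt0 ?exprn_gt0// => /ltW.
rewrite -EFinM => H; apply: le_trans H.
by rewrite lee_fin le_eqVlt; apply/orP; left; apply/eqP; field.
Qed.

Lemma second_diff_quot_fin (R : realType) (n : nat) (F : 'cV[R]_n -> \bar R)
    (xbar v w : 'cV[R]_n) (t a b : R) : 0 < t -> F xbar = a%:E ->
  F (xbar + t *: w) = b%:E ->
  second_diff_quot F xbar v t w = ((b - a - t * dot v w) / (2^-1 * t ^+ 2))%:E.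
Proof. by move=> t0 Fa Fb; rewrite /second_diff_quot Fa Fb -!EFinD -EFinM. Qed.

(* Minimizing the second-order difference quotient plus the quadratic form and
   [|w - w0|^2] over the ball of radius [e] around [w0] localizes the minimizer,
   whose optimality condition is the subgradient. *)
Lemma second_subderiv_min_reg_subdiff (R : realType) (n : nat)
    (F : 'cV[R]_n -> \bar R) (xbar v w0 : 'cV[R]_n) (B : 'M[R]_n) :
  B^T = B -> (forall x, F x <> -oo%E) -> F xbar \is a fin_num ->
  (\forall x \near xbar, lsc_at F x) ->
  (forall w, ((- dot (B *m w) w)%:E <= second_subderiv F xbar v w)%E) ->
  (second_subderiv F xbar v w0 <= (- dot (B *m w0) w0)%:E)%E ->
  forall e : R, 0 < e -> exists t w' z, [/\ 0 < t, t < e,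
    enorm (w' - w0) < e, enorm (z + B *m w0) < e &
    reg_subdiff F (xbar + t *: w') (v + t *: z)].
Proof.
move=> BT FN Fx /nbhs_enormP[rl rl0 Flsc] sdge sdle e0 e00.
have [K K0 BK] := ler_mulmx_enorm B.
(* The final [z + B *m w0] is minus the image of [w - w0] under [B + 1], hence of norm below
   [(K + 1) * e = e0]. *)
pose e := e0 / (K + 1).
have K1 : 0 < K + 1 by rewrite addr_gt0.
have e_gt0 : 0 < e by rewrite divr_gt0.
have eK : (K + 1) * e = e0 by rewrite /e mulrC divfK// gt_eqF.
have ee0 : e < e0 by rewrite -eK ltr_pMl// ltrDr.
have e2 : 0 < e ^+ 2 by rewrite exprn_gt0.
pose Q w := dot (B *m w) w.
have Qc w : Q z @[z --> w] --> Q w.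
  apply: (@cvg_dot _ _ _ (nbhs w) (fun z => B *m z) id) => //.
  exact: (@cvg_mulmx _ _ _ (nbhs w) B id).
(* Quotient plus [Q] plus penalty exceeds [- e^2 / 2 + e^2] on the sphere of radius [e], whereas at
   the [w'] chosen below it is less than [e^2 / 4 + e^2 / 8 + e^2 / 16]. *)
have [|d1 d10 hd1] := @sphere_uniform R n w0 e
    (fun t w => ((- Q w - e ^+ 2 / 2)%:E < second_diff_quot F xbar v t w)%E).
  move=> w _.
  have [|a a0 ha] := @second_subderiv_gt _ _ F xbar v w (- Q w - e ^+ 2 / 4)%:E.
    by apply: lt_le_trans (sdge w); rewrite lte_fin -/(Q w); lra.
  have /nbhs_enormP[b b0 hb] : \forall z \near w, Q w - e ^+ 2 / 4 < Q z.
    by apply: cvgr_gt (Qc w) _ _; lra.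
  exists (Num.min a b); first by rewrite lt_min a0.
  move=> t z t0; rewrite !lt_min => /andP[ta _] /andP[za zb].
  apply: lt_trans (ha t z t0 ta za); rewrite lte_fin.
  by have := hb z zb; lra.
pose d2 := rl / (enorm w0 + e + 1).
have w1 : 0 < enorm w0 + e + 1 by have := enorm_ge0 w0; lra.
have d20 : 0 < d2 by rewrite divr_gt0.
have /nbhs_enormP[d3 d30 hd3] : \forall z \near w0, Q z < Q w0 + e ^+ 2 / 8.
  by apply: cvgr_lt (Qc w0) _ _; lra.
pose d := Num.min (Num.min d1 d2) (Num.min d3 (e / 4)).
have d0 : 0 < d by rewrite !lt_min d10 d20 d30 divr_gt0.
have [|t [w' [t0 td wd hw']]] := @second_subderiv_lt _ _ F xbar v w0
    (- Q w0 + e ^+ 2 / 4)%:E _ d d0.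
  by apply: le_lt_trans sdle _; rewrite lte_fin -/(Q w0); lra.
move: td wd; rewrite !lt_min => /andP[/andP[td1 td2] /andP[_ te]].
move=> /andP[_ /andP[wd3 we]].
have [a Fa] : exists a, F xbar = a%:E by exists (fine (F xbar)); rewrite fineK.
have T0 : 0 < 2^-1 * t ^+ 2 by rewrite mulr_gt0 ?exprn_gt0.
have [b Fb] : exists b, F (xbar + t *: w') = b%:E.
  move: hw' (FN (xbar + t *: w')); rewrite /second_diff_quot Fa.
  case: (F (xbar + t *: w')) => [b| |] // H _; first by exists b.
  by move: H; rewrite gt0_mulye ?lte_fin ?invr_gt0// ltNge leey.
rewrite (second_diff_quot_fin v t0 Fa Fb) lte_fin ltr_pdivrMr// in hw'.
pose x0 := xbar + t *: w0.
(* In the variable [z] with [x = xbar + t *: z], adding this quadratic to [F] gives [t^2 / 2] times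
   quotient plus [Q] plus penalty, up to a constant; the summand [1%:M] of [C] is the penalty. *)
pose b0 := - v + t *: (B *m w0); pose C := B + 1%:M.
have CT : C^T = C by rewrite /C linearD/= BT trmx1.
have qE z : quad b0 C (xbar + t *: z - x0) =
    - t * dot v z + 2^-1 * t ^+ 2 * (Q z + enorm (z - w0) ^+ 2) +
    (t * dot v w0 - 2^-1 * t ^+ 2 * Q w0).
  have -> : xbar + t *: z - x0 = t *: (z - w0).
    by rewrite /x0 opprD addrACA subrr add0r -scalerBr.
  have E : dot (B *m z) w0 = dot (B *m w0) z by rewrite dot_mulmx BT dotC.
  rewrite /quad /b0 /C /Q enorm_sqr mulmxDl mul1mx -!scalemxAr !mulmxBr !dotE E.
  by rewrite (dotC w0 z); field.
have w'e2 : enorm (w' - w0) ^+ 2 <= e ^+ 2 / 16.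
  have -> : e ^+ 2 / 16 = (e / 4) ^+ 2 by field.
  by have := enorm_ge0 (w' - w0); nra.
have Qw' := hd3 w' wd3.
have key : b + quad b0 C (xbar + t *: w' - x0) <
    a + (t * dot v w0 - 2^-1 * t ^+ 2 * Q w0) + 2^-1 * t ^+ 2 * (e ^+ 2 / 2).
  rewrite qE.
  have : (2^-1 * t ^+ 2) * (- Q w0 + e ^+ 2 / 4 + Q w' + enorm (w' - w0) ^+ 2) <
     (2^-1 * t ^+ 2) * (e ^+ 2 / 2) by rewrite ltr_pM2l//; lra.
  by rewrite !mulrDr; lra.
have yz y : y = xbar + t *: (t^-1 *: (y - xbar)).
  by rewrite scalerA divff ?gt_eqF// scale1r addrC subrK.
have x0E z : enorm (xbar + t *: z - x0) = t * enorm (z - w0).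
  by rewrite /x0 opprD addrACA subrr add0r -scalerBr enormZ gtr0_norm.
have [||||||y [yr _ ysub]] := @interior_min_reg_subdiff _ _ F x0 (t * e) b0 C (xbar + t *: w').
- exact: CT.
- exact: FN.
- move=> x xx; apply: Flsc; apply: le_lt_trans (ler_enorm_dist _ x0 _) _.
  have -> : x0 - xbar = t *: w0 by rewrite /x0 addrC addKr.
  rewrite enormZ gtr0_norm//.
  rewrite ltr_pdivlMr// in td2.
  by move: xx; rewrite /cball/=; lra.
- by rewrite /cball/= x0E ler_pM2l// ltW//; lra.
- by rewrite Fb ltry.
- move=> y; rewrite (yz y); set z := t^-1 *: _; rewrite x0E => /mulfI.
  rewrite gt_eqF// => /(_ isT) ze.
  have := hd1 t t0 td1 z ze; rewrite Fb.
  case Fc : (F (xbar + t *: z)) (FN (xbar + t *: z)) => [c| |] // _ H; last first.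
    by rewrite addye// -EFinD ltry.
  rewrite (second_diff_quot_fin v t0 Fa Fc) lte_fin ltr_pdivlMr// in H.
  rewrite -!EFinD lte_fin; apply: (lt_trans key); rewrite qE ze.
  by rewrite !mulrDr; lra.
pose w := t^-1 *: (y - xbar).
have yE : y = xbar + t *: w := yz y.
have we' : enorm (w - w0) < e by move: yr; rewrite yE x0E ltr_pM2l.
exists t, w, (- (B *m w) - (w - w0)); split.
- exact: t0.
- by apply: lt_trans ee0; lra.
- exact: lt_trans we' ee0.
- have -> : - (B *m w) - (w - w0) + B *m w0 = - (B *m (w - w0) + (w - w0)).
    by rewrite mulmxBr; apply/colP => i; rewrite !mxE; ring.
  rewrite enormN; apply: le_lt_trans (ler_enormD _ _) _.
  have := BK (w - w0); rewrite -eK => h.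
  have : (K + 1) * enorm (w - w0) < (K + 1) * e by rewrite ltr_pM2l.
  by lra.
have <- : - (b0 + C *m (y - x0)) = v + t *: (- (B *m w) - (w - w0)).
  have -> : y - x0 = t *: (w - w0).
    by rewrite {1}yE /x0 opprD addrACA subrr add0r -scalerBr.
  rewrite /b0 /C mulmxDl mul1mx -scalemxAr mulmxBr.
  by apply/colP => i; rewrite !mxE; ring.
by rewrite -yE.
Qed.

Lemma second_diff_quot_sum (R : realType) (n : nat) (f phi psi : 'cV[R]_n -> \bar R)
    (xbar : 'cV[R]_n) (A : 'M[R]_n) :
  (forall x, psi x <> -oo%E) -> psi xbar \is a fin_num ->
  (forall x, f x = (phi x + psi x)%E) -> is_ext_hessian phi xbar A ->
  forall w e, 0 < e -> exists2 d : R, 0 < d & forall t w', 0 < t -> t < d ->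
    enorm (w' - w) < d -> exists2 r : R, `|r - dot (A *m w) w| <= e &
      second_diff_quot f xbar 0 t w' =
      (second_diff_quot psi xbar (- gradient phi xbar) t w' + r%:E)%E.
Proof.
move=> psiN psix fE hA w e e0.
have [[phif _] _] := hA; have [_ _ tay] := ext_hessian_expansion hA.
have phix : phi xbar \is a fin_num by exact: nbhs_singleton phif.
pose W := enorm w + 1.
have W0 : 0 < W by rewrite ltr_wpDl ?enorm_ge0.
(* Since [W] bounds [enorm z], the Taylor error divided by [t^2 / 2] is at most
   [2 * e1 * W^2 = e / 2]; the other half of [e] pays for replacing [z] by [w] in the quadratic
   form. *)
pose e1 := e / (4 * W ^+ 2).
have e10 : 0 < e1 by rewrite divr_gt0 ?mulr_gt0 ?exprn_gt0.
have /nbhs_enormP[d1 d10 hd1] := phif.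
have /nbhs_enormP[d2 d20 hd2] := tay e1 e10.
have /nbhs_enormP[d3 d30 hd3] : \forall z \near w,
    `|dot (A *m z) z - dot (A *m w) w| < e / 2.
  have Qc : dot (A *m z) z @[z --> w] --> dot (A *m w) w.
    apply: (@cvg_dot _ _ _ (nbhs w) (fun z => A *m z) id) => //.
    exact: (@cvg_mulmx _ _ _ (nbhs w) A id).
  move/cvgrPdist_lt : Qc => /(_ (e / 2)); rewrite divr_gt0// => /(_ isT).
  by apply: filterS => z; rewrite distrC.
pose d := Num.min (Num.min d3 1) (Num.min (d1 / W) (d2 / W)).
have d0 : 0 < d by rewrite !lt_min d30 ltr01 !divr_gt0.
exists d => // t z t0; rewrite !lt_min => /andP[_ /andP[t1 t2]].
move=> /andP[/andP[z3 z1] _].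
have zW : enorm z < W.
  rewrite -[z](subrK w) addrC /W; apply: le_lt_trans (ler_enormD _ _) _.
  by rewrite ltrD2l.
have xE : xbar + t *: z - xbar = t *: z by rewrite addrC addKr.
have tz : enorm (t *: z) < t * W by rewrite enormZ gtr0_norm// ltr_pM2l.
have p1 : phi (xbar + t *: z) \is a fin_num.
  by apply: hd1; rewrite xE; apply: lt_trans tz _; rewrite -ltr_pdivlMr.
have := hd2 (xbar + t *: z); rewrite xE.
have tz2 : enorm (t *: z) < d2 by apply: lt_trans tz _; rewrite -ltr_pdivlMr.
move=> /(_ tz2).
set h1 := fine (phi (xbar + t *: z)); set h0 := fine (phi xbar) => htay.
have T0 : 0 < 2^-1 * t ^+ 2 by rewrite mulr_gt0 ?exprn_gt0.
exists ((h1 - h0 - t * dot (gradient phi xbar) z) / (2^-1 * t ^+ 2)).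
  set r := _ / _.
  have rE : r * (2^-1 * t ^+ 2) = h1 - h0 - t * dot (gradient phi xbar) z.
    by rewrite /r divfK// gt_eqF.
  have h2 : `|r - dot (A *m z) z| <= e / 2.
    rewrite -(ler_pM2r T0) -{1}(gtr0_norm T0) -normrM mulrBl rE.
    have -> : h1 - h0 - t * dot (gradient phi xbar) z -
        dot (A *m z) z * (2^-1 * t ^+ 2) =
        h1 - h0 - quad (gradient phi xbar) A (t *: z).
      by rewrite /quad -scalemxAr !dotE; ring.
    apply: (le_trans htay).
    have tzW : enorm (t *: z) ^+ 2 <= (t * W) ^+ 2.
      by rewrite ler_sqr ?nnegrE ?enorm_ge0 ?mulr_ge0 ?ltW.
    have := tzW; rewrite -(ler_pM2l e10) => /le_trans; apply.
    rewrite /e1 le_eqVlt; apply/orP; left; apply/eqP.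
    by field; rewrite gt_eqF.
  have h3 := hd3 z z3.
  have -> : r - dot (A *m w) w =
    (r - dot (A *m z) z) + (dot (A *m z) z - dot (A *m w) w) by ring.
  by apply: le_trans (ler_normD _ _) _; lra.
rewrite /second_diff_quot !fE dot0l mulr0 sube0 dotNl.
rewrite -(fineK p1) -(fineK phix) -(fineK psix) -/h1 -/h0.
case: (psi (xbar + t *: z)) (psiN (xbar + t *: z)) => [b| |] // _.
  rewrite -?EFinN -?EFinD -?EFinN -?EFinM.
  congr _%:E.
  by rewrite -mulrDl; congr (_ * _); ring.
by rewrite /= !gt0_mulye ?lte_fin ?invr_gt0.
Qed.

(** The [phi] part of the difference quotient converges, and a convergent real term can be taken out
    of a lower limit. *)
Lemma second_subderiv_sum (R : realType) (n : nat) (f phi psi : 'cV[R]_n -> \bar R)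
    (xbar : 'cV[R]_n) (A : 'M[R]_n) :
  (forall x, psi x <> -oo%E) -> psi xbar \is a fin_num ->
  (forall x, f x = (phi x + psi x)%E) -> is_ext_hessian phi xbar A ->
  forall w, second_subderiv f xbar 0 w =
    ((dot (A *m w) w)%:E + second_subderiv psi xbar (- gradient phi xbar) w)%E.
Proof.
move=> psiN psix fE hA w.
have H := second_diff_quot_sum psiN psix fE hA w.
apply/eqP; rewrite eq_le; apply/andP; split.
  rewrite addeC -leeBlDr// addeC -EFinN.
  apply: second_subderiv_shift => e e0; have [d d0 hd] := H e e0.
  exists d => // t z t0 td zd; have [r re ->] := hd t z t0 td zd.
  rewrite -addeA -EFinD geeDl// lee_fin.
  by move: re; rewrite ler_norml => /andP[]; lra.
apply: second_subderiv_shift => e e0; have [d d0 hd] := H e e0.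
exists d => // t z t0 td zd; have [r re ->] := hd t z t0 td zd.
rewrite leeD2l// lee_fin.
by move: re; rewrite ler_norml => /andP[]; lra.
Qed.

Lemma lsc_at_near_eq (R : realType) (X : topologicalType) (F G : X -> \bar R) (x : X) :
  (\forall y \near x, F y = G y) -> lsc_at F x -> lsc_at G x.
Proof.
move=> FG Flsc a; rewrite -(nbhs_singleton FG) => /Flsc H.
by apply: filterS2 FG H => y <-.
Qed.

Lemma continuous_dist (R : realType) (X : topologicalType) (h : X -> R) (x : X) :
  (forall e, 0 < e -> \forall y \near x, `|h x - h y| < e) ->
  {for x, continuous h}.
Proof. by move=> H; apply/cvgrPdist_lt => e /H. Qed.

Lemma lsc_sum_near (R : realType) (n : nat) (f phi psi : 'cV[R]_n -> \bar R)
    (xbar : 'cV[R]_n) (A : 'M[R]_n) :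
  (forall x, f x = (phi x + psi x)%E) -> is_ext_hessian phi xbar A ->
  (\forall x \near xbar, lsc_at psi x) -> \forall x \near xbar, lsc_at f x.
Proof.
move=> fE hA psil.
have [[phif _] _] := hA.
have [[L L0 [[U V] /= [nU nV] hL]] _ _] := ext_hessian_expansion hA.
have /nbhs_enormP[d d0 hd] : nbhs xbar
    ([set y | phi y \is a fin_num /\ lsc_at psi y] `&` (U `&` V)).
  by apply: filterI; exact: filterI.
apply/nbhs_enormP; exists d => // x xd.
have [_ [Ux Vx]] := hd x xd.
have near_x : \forall y \near x, enorm (y - xbar) < d.
  apply/nbhs_enormP; exists (d - enorm (x - xbar)); first by rewrite subr_gt0.
  move=> y yx; apply: le_lt_trans (ler_enorm_dist y x xbar) _.
  by rewrite -ltrBrDr.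
apply: (@lsc_at_near_eq _ _ (fun y => psi y + (fine (phi y))%:E)%E).
  apply: filterS near_x => y /hd[[phiy _] _].
  by rewrite fE fineK// addeC.
apply: lsc_at_addr; last by have [[]] := hd x xd.
apply: continuous_dist => e e0.
have eL : 0 < e / L by exact: divr_gt0.
apply: filterS2 near_x (enorm_near x eL) => y /hd[_ [_ Vy]] yx.
apply: le_lt_trans (hL (x, y) (conj Ux Vy)) _ => /=.
by rewrite enormB mulrC -ltr_pdivlMr.
Qed.

(** * Graphical derivatives and subregularity *)

Lemma tangent_graphI (R : realType) (n : nat) (F : 'cV[R]_n -> \bar R)
    (xbar v w z : 'cV[R]_n) :
  (forall e : R, 0 < e -> exists t w' z', [/\ 0 < t, t < e, enorm (w' - w) < e,
    enorm (z' - z) < e & lim_subdiff F (xbar + t *: w') (v + t *: z')]) ->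
  subgrad_graph_deriv F xbar v w z.
Proof.
move=> h.
have h' (k : nat) : exists p : R * ('cV[R]_n * 'cV[R]_n),
    [/\ 0 < p.1, p.1 < k.+1%:R^-1, enorm (p.2.1 - w) < k.+1%:R^-1,
      enorm (p.2.2 - z) < k.+1%:R^-1 &
      lim_subdiff F (xbar + p.1 *: p.2.1) (v + p.1 *: p.2.2)].
  have [|t [w' [z' H]]] := h k.+1%:R^-1; first by rewrite invr_gt0.
  by exists (t, (w', z')).
have [p hp] := choice h'.
have inv_lt (e : R) : 0 < e -> \forall k \near \oo, k.+1%:R^-1 < e.
  move=> e0; have := @cvg_harmonic R => /cvgr_lt /(_ e e0).
  by apply.
exists (fun k => (p k).1), (fun k => (p k).2); split.
- by move=> k; have [] := hp k.
- apply/cvgrPdist_lt => e /inv_lt; apply: filterS => k ke.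
  have [p0 p1 _ _ _] := hp k.
  by rewrite sub0r normrN gtr0_norm//; exact: lt_trans ke.
- move=> S [[Q1 Q2] /= [/nbhs_enormP[a a0 ha] /nbhs_enormP[b b0 hb]] QS].
  apply: filterS2 (inv_lt a a0) (inv_lt b b0) => k ka kb.
  have [_ _ p1 p2 _] := hp k.
  by apply: QS; split; [apply: ha; exact: lt_trans ka|apply: hb; exact: lt_trans kb].
- by move=> k; have [_ _ _ _] := hp k.
Qed.

(** By compactness, the absence of tangent vectors [(w, - (A *m w))] with unit [w] holds with a
    uniform margin. A subgradient of [f] that is too small compared with the distance to [xbar]
    would produce a point of the graph of the subdifferential of [psi] inside this margin. *)
Lemma strongly_subregular_sum (R : realType) (n : nat) (f phi psi : 'cV[R]_n -> \bar R)
    (xbar : 'cV[R]_n) (A : 'M[R]_n) :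
  (forall x, psi x <> -oo%E) -> (forall x, f x = (phi x + psi x)%E) ->
  is_ext_hessian phi xbar A -> (\forall x \near xbar, lsc_at psi x) ->
  (forall w, enorm w = 1 ->
    ~ subgrad_graph_deriv psi xbar (- gradient phi xbar) w (- (A *m w))) ->
  lim_subdiff f xbar 0 -> strongly_subregular (lim_subdiff f) xbar 0.
Proof.
move=> psiN fE hA psil noD f0; split=> //.
set v := - gradient phi xbar in noD *.
have [[phif _] _] := hA; have [_ lin _] := ext_hessian_expansion hA.
have [K K0 AK] := ler_mulmx_enorm A.
have [|d d0 hd] := @sphere_uniform R n 0 1 (fun t w => forall s w' z', 0 < s -> s < t ->
    enorm (w' - w) < t -> enorm (z' + A *m w) < t ->
    ~ lim_subdiff psi (xbar + s *: w') (v + s *: z')).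
  move=> w; rewrite subr0 => /noD nD.
  have [e e0 he] : exists2 e : R, 0 < e & forall t w' z', 0 < t -> t < e ->
      enorm (w' - w) < e -> enorm (z' + A *m w) < e ->
      ~ lim_subdiff psi (xbar + t *: w') (v + t *: z').
    apply: contrapT => no; apply: nD; apply: tangent_graphI => e e0.
    apply: contrapT => no'; apply: no; exists e => // t w' z' t0 te we ze H.
    by apply: no'; exists t, w', z'; rewrite opprK; split.
  (* Passing from [w] to a unit vector [w1] within [d] adds up two distances below [d] in the first
     component and at most [(K + 1) * d] in the second. *)
  pose d := e / (K + 2).
  have K2 : 0 < K + 2 by rewrite addr_gt0.
  have d0 : 0 < d by exact: divr_gt0.
  have dE : (K + 2) * d = e by rewrite /d mulrC divfK// gt_eqF.
  have Kd : 0 < K * d by exact: mulr_gt0.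
  exists d => // t w1 t0 td w1d s w' z' s0 st w't z't.
  apply: he => //; first lra.
    by apply: le_lt_trans (ler_enorm_dist _ w1 _) _; lra.
  have -> : z' + A *m w = (z' + A *m w1) + A *m (w - w1).
    by rewrite mulmxBr [RHS]addrC (addrC z' (A *m w1)) addrA subrK addrC.
  apply: le_lt_trans (ler_enormD _ _) _.
  have := AK (w - w1); rewrite enormB => h.
  have : K * enorm (w1 - w) < K * d by rewrite ltr_pM2l.
  by lra.
pose e := d / 2.
have e0 : 0 < e by rewrite divr_gt0.
have ed : e < d by rewrite /e; lra.
(* The lower bound for [psi] has defect [2 * (e2 * t)]: one [e2 * t] from the regular subgradient of
   [f], one from the linear estimate of [phi]. [approx_reg_subdiff] doubles it to [e * t / 4], and
   the subgradient [u'] adds less than [e * t / 4]. *)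
pose e2 := e / 16.
have e20 : 0 < e2 by rewrite divr_gt0.
have [d2 d20 hd2] := lin e2 e20.
have /nbhs_enormP[d1 d10 hd1] := phif.
have /nbhs_enormP[d3 d30 hd3] := psil.
pose del := Num.min (Num.min d1 d2) (Num.min d3 e).
have del0 : 0 < del by rewrite !lt_min d10 d20 d30.
have main x u : lim_subdiff f x u -> enorm (x - xbar) < del ->
    e / 4 * enorm (x - xbar) <= enorm u.
  move=> [_ [x_ [u_ [x_x _ u_u fu]]]] xdel; rewrite leNgt; apply/negP => ux.
  (* The strict inequalities persist along the sequences defining the limiting subgradient, so a
     regular subgradient can be used instead. *)
  have c1 : enorm (x_ k - xbar) @[k --> \oo] --> enorm (x - xbar).
    by apply: cvg_enorm; apply: cvgB => //; exact: cvg_cst.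
  have c2 : e / 4 * enorm (x_ k - xbar) - enorm (u_ k) @[k --> \oo] -->
      e / 4 * enorm (x - xbar) - enorm u.
    by apply: cvgB; [apply: cvgM => //; exact: cvg_cst|exact: cvg_enorm].
  have h1 : \forall k \near \oo, enorm (x_ k - xbar) < del by exact: cvgr_lt c1 _ xdel.
  have h2 : \forall k \near \oo, 0 < e / 4 * enorm (x_ k - xbar) - enorm (u_ k).
    by apply: cvgr_gt c2 _ _; rewrite subr_gt0.
  have [k [xk uk]] := filter_ex (filterI h1 h2).
  have reg := fu k; move: xk uk reg; set x' := x_ k; set u' := u_ k => xk uk reg.
  move: xk; rewrite !lt_min => /andP[/andP[x1 x2] /andP[x3 xe]].
  set t := enorm (x' - xbar) in uk x1 x2 x3 xe *.
  have t0 : 0 < t by have := enorm_ge0 u'; move: e0 uk => e0 uk h; nra.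
  have phix := hd1 x' x1.
  have psix : psi x' \is a fin_num.
    case: reg => + _; rewrite /edom/= fE -(fineK phix).
    by case: (psi x') (psiN x').
  have fx : f x' \is a fin_num by rewrite fE fin_numD phix psix.
  have et0 : 0 < e2 * t by exact: mulr_gt0.
  have sub := reg_subdiffE fx reg et0.
  have linx := hd2 x' t0 x2.
  have phi_near : \forall y \near x', phi y \is a fin_num.
    apply/nbhs_enormP; exists (d1 - t); first by rewrite subr_gt0.
    move=> y yx; apply: hd1; apply: le_lt_trans (ler_enorm_dist y x' xbar) _.
    by rewrite -ltrBrDr.
  have psil_near : \forall z \near x', lsc_at psi z.
    apply/nbhs_enormP; exists (d3 - t); first by rewrite subr_gt0.
    move=> y yx; apply: hd3; apply: le_lt_trans (ler_enorm_dist y x' xbar) _.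
    by rewrite -ltrBrDr.
  pose v0 := u' - (gradient phi xbar + A *m (x' - xbar)).
  have low : \forall y \near x',
      (psi x' + (dot v0 (y - x') - 2 * (e2 * t) * enorm (y - x'))%:E <= psi y)%E.
    apply: filterS3 phi_near sub linx => y phiy.
    rewrite !fE -(fineK phix) -(fineK phiy) -(fineK psix).
    case: (psi y) (psiN y) => [b| |] // _; last by move=> _ _; rewrite leey.
    rewrite -!EFinD !lee_fin /v0 => s1.
    rewrite ler_norml => /andP[_ s2]; rewrite dotDl dotNl.
    by move: s1 s2; rewrite -/t /=; lra.
  have eta0 : 0 <= 2 * (e2 * t) by rewrite mulr_ge0// ltW.
  have [|y [v' [yx v'v0 v'sub]]] :=
    approx_reg_subdiff psiN psil_near psix eta0 (_ : 0 < e * t) low.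
    exact: mulr_gt0.
  pose w := t^-1 *: (x' - xbar).
  have w1 : enorm (w - 0) = 1.
    by rewrite subr0 enormZ gtr0_norm ?invr_gt0// mulVf// gt_eqF.
  apply: (hd e e0 ed w w1 t (t^-1 *: (y - xbar)) (t^-1 *: (v' - v))) => //.
  - have -> : t^-1 *: (y - xbar) - w = t^-1 *: (y - x').
      by rewrite /w -scalerBr opprB addrA subrK.
    by rewrite enormZ gtr0_norm ?invr_gt0// mulrC ltr_pdivrMr.
  - have -> : t^-1 *: (v' - v) + A *m w = t^-1 *: ((v' - v0) + u').
      rewrite /w -scalemxAr -scalerDr; congr (_ *: _).
      by rewrite /v0 /v; apply/colP => i; rewrite !mxE; ring.
    rewrite enormZ gtr0_norm ?invr_gt0// mulrC ltr_pdivrMr//.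
    apply: le_lt_trans (ler_enormD _ _) _.
    by move: v'v0 uk (mulr_gt0 e0 t0); rewrite /e2; lra.
  rewrite !scalerA divff ?gt_eqF// !scale1r.
  by rewrite [xbar + _]addrC subrK [v + _]addrC subrK; exact: reg_subdiff_lim.
exists (4 / e); first exact: divr_gt0.
apply/nbhs_enormP; exists del => // x xdel.
have : ((e / 4 * enorm (x - xbar))%:E <= Defs.edist 0%R (lim_subdiff f x))%E.
  apply: le_ereal_inf_tmp => _ [u fu <-].
  by rewrite sub0r enormN lee_fin; exact: main.
have c0 : (0 <= (4 / e)%:E)%E by rewrite lee_fin ltW// divr_gt0.
move=> /(lee_wpmul2l c0); apply: le_trans.
by rewrite -EFinM lee_fin le_eqVlt; apply/orP; left; apply/eqP; field; rewrite gt_eqF.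
Qed.

(** Prox-regularity with base point [xbar] and subgradient [v] bounds each difference quotient below
    by [- r] times the squared norm of its direction. In particular the second subderivative is
    never -oo. *)
Lemma prox_second_subderiv_ge (R : realType) (n : nat) (psi : 'cV[R]_n -> \bar R)
    (xbar v : 'cV[R]_n) : (forall x, psi x <> -oo%E) -> prox_regular psi xbar v ->
  exists r : R, forall w,
    ((- (r * enorm w ^+ 2))%:E <= second_subderiv psi xbar v w)%E.
Proof.
move=> psiN [dompsi psiv [r [eps [r0 eps0 H]]]].
have psix : psi xbar \is a fin_num.
  by move: dompsi (psiN xbar); rewrite /edom/=; case: (psi xbar).
exists r => w; apply: second_subderiv_ge => e e0.
have Qc : r * enorm z ^+ 2 @[z --> w] --> r * enorm w ^+ 2.
  apply: (@cvgM R _ (nbhs w) _ (fun=> r)); first exact: cvg_cst.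
  by apply: (@cvgM R _ (nbhs w)); apply: (@cvg_enorm _ _ _ (nbhs w) id).
have /nbhs_enormP[d d0 hd] : \forall z \near w, r * enorm z ^+ 2 < r * enorm w ^+ 2 + e.
  by apply: cvgr_lt Qc _ _; rewrite ltrDl.
have W0 : 0 < enorm w + d by rewrite ltr_wpDl ?enorm_ge0.
exists (Num.min d (eps / (enorm w + d))); first by rewrite lt_min d0 divr_gt0.
move=> t z t0; rewrite !lt_min => /andP[_ td] /andP[zd _].
rewrite ltr_pdivlMr// in td.
have zW : enorm z < enorm w + d.
  by rewrite -[z](subrK w) addrC; apply: le_lt_trans (ler_enormD _ _) _; rewrite ltrD2l.
have xE : xbar + t *: z - xbar = t *: z by rewrite addrC addKr.
have tz : enorm (t *: z) <= eps.
  rewrite enormZ gtr0_norm//; apply: ltW; apply: lt_trans td; by rewrite ltr_pM2l.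
have cx : cball xbar eps xbar by rewrite /cball/= subrr enorm0 ltW.
have := H (xbar + t *: z) xbar; rewrite /cball/= xE => /(_ tz cx).
rewrite subee// abse0 lte_fin => /(_ eps0 v psiv).
rewrite subrr enorm0 => /(_ (ltW eps0)).
have T0 : 0 < 2^-1 * t ^+ 2 by rewrite mulr_gt0 ?exprn_gt0.
rewrite /second_diff_quot lee_pdivlMr// -(fineK psix).
case: (psi (xbar + t *: z)) (psiN (xbar + t *: z)) => [b| |] // _; last first.
  by move=> _; rewrite -EFinM /= leey.
rewrite -EFinM -!EFinD !lee_fin enormZ gtr0_norm// dotZr => h.
have h2 := hd z zd.
have : (2^-1 * t ^+ 2) * (r * enorm z ^+ 2) <= (2^-1 * t ^+ 2) * (r * enorm w ^+ 2 + e).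
  by rewrite ler_pM2l// ltW.
by rewrite exprMn in h; lra.
Qed.

(** A bound valid for all small [t] and all directions within [d] of [w] also serves every direction
    within [d / 2]. *)
Lemma lsc_second_subderiv (R : realType) (n : nat) (F : 'cV[R]_n -> \bar R)
    (xbar v w : 'cV[R]_n) : lsc_at (second_subderiv F xbar v) w.
Proof.
move=> a /lte_dense_EFin[b ab /second_subderiv_gt[d d0 hd]].
apply/nbhs_enormP; exists (d / 2); first exact: divr_gt0.
move=> w1 w1d; apply: lt_le_trans ab _; apply: second_subderiv_ge => e e0.
exists (d / 2); first exact: divr_gt0.
move=> t z t0 td zd; apply: (@le_trans _ _ b%:E); first by rewrite lee_fin; lra.
apply/ltW/hd => //; first lra.
by apply: le_lt_trans (ler_enorm_dist z w1 w) _; lra.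
Qed.

(* Testing prox-regularity at [xbar + t w_k] against the recovery sequence of
   [lam w] and letting [lam] increase to 1 yields [d^2 psi w <= <z, w>]. *)
Lemma second_subderiv_le_graph_deriv (R : realType) (n : nat)
    (psi : 'cV[R]_n -> \bar R) (xbar v w z : 'cV[R]_n) :
  (forall x, psi x <> -oo%E) -> subdiff_continuous psi xbar v ->
  prox_regular psi xbar v -> twice_epi_differentiable psi xbar v ->
  subgrad_graph_deriv psi xbar v w z ->
  (second_subderiv psi xbar v w <= (dot z w)%:E)%E.
Proof.
move=> psiN subc [dompsi psiv [r [eps [r0 eps0 prox]]]] epi.
move=> [t [p [t0 tcvg pcvg pgr]]].
have psix : psi xbar \is a fin_num.
  by move: dompsi (psiN xbar); rewrite /edom/=; case: (psi xbar).
pose W k := (p k).1; pose Z k := (p k).2.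
have Wcvg : W @ \oo --> w by exact: (cvg_comp _ _ pcvg cvg_fst).
have Zcvg : Z @ \oo --> z by exact: (cvg_comp _ _ pcvg cvg_snd).
pose u k := xbar + t k *: W k; pose s k := v + t k *: Z k.
have uv k : lim_subdiff psi (u k) (s k) := pgr k.
have shift_cvg (a b : 'cV[R]_n) (q : nat -> 'cV[R]_n) : q @ \oo --> b ->
    (fun k => a + t k *: q k) @ \oo --> a.
  move=> qb; have : (fun k => a + t k *: q k) @ \oo --> a + 0 *: b.
    by apply: cvgD; [exact: cvg_cst|exact: cvgZ].
  by rewrite scale0r addr0.
have ucvg : u @ \oo --> xbar by exact: shift_cvg Wcvg.
have scvg : s @ \oo --> v by exact: shift_cvg Zcvg.
have psiu k : psi (u k) \is a fin_num.
  have [+ _] := uv k; rewrite /edom/=.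
  by move: (psiN (u k)); case: (psi (u k)).
have near_prox : \forall k \near \oo, forall x, cball xbar eps x ->
    (psi (u k) + (dot (s k) (x - u k) - r / 2 * enorm (x - u k) ^+ 2)%:E <= psi x)%E.
  have h1 : \forall k \near \oo, (`|psi (u k) - psi xbar| < eps%:E)%E.
    have : psi \o u @ \oo --> (fine (psi xbar))%:E.
      by rewrite fineK//; exact: subc ucvg scvg uv.
    move=> /fine_cvgP[_ /cvgrPdist_lt /(_ eps eps0)]; apply: filterS => k /=.
    rewrite -[psi (u k)]fineK// -[X in (_ - X)%E](fineK psix) -EFinB abse_EFin lte_fin.
    by rewrite distrC.
  move/cvg_enormP : ucvg => /(_ eps eps0) h2; move/cvg_enormP : scvg => /(_ eps eps0) h3.
  apply: filterS3 h1 h2 h3 => k k1 k2 k3 x xe.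
  by apply: prox => //; exact: ltW.
have [a xa] : exists a, psi xbar = a%:E by exists (fine (psi xbar)); rewrite fineK.
have T0 k : 0 < 2^-1 * t k ^+ 2 by rewrite mulr_gt0 ?exprn_gt0.
pose D2 k := (fine (psi (u k)) - a - t k * dot v (W k)) / (2^-1 * t k ^+ 2).
have D2E k : second_diff_quot psi xbar v (t k) (W k) = (D2 k)%:E.
  by rewrite (second_diff_quot_fin v (t0 k) xa (esym (fineK (psiu k)))).
have D2eq k : D2 k * (2^-1 * t k ^+ 2) = fine (psi (u k)) - a - t k * dot v (W k).
  by rewrite /D2 divfK// gt_eqF.
have near_D2 (c : R) : (c%:E < second_subderiv psi xbar v w)%E ->
    \forall k \near \oo, c < D2 k.
  move=> /second_subderiv_gt[d d0 hd].
  move/cvg_enormP : Wcvg => /(_ d d0) h1.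
  have h2 : \forall k \near \oo, t k < d by exact: cvgr_lt tcvg _ d0.
  by apply: filterS2 h1 h2 => k k1 k2; rewrite -lte_fin -D2E; exact: hd.
have ZW : dot (Z k) (W k) @[k --> \oo] --> dot z w by exact: cvg_dot.
have WW : enorm (W k) ^+ 2 @[k --> \oo] --> enorm w ^+ 2.
  by apply: cvgM; exact: cvg_enorm.
(* Prox-regularity from [u k] to [xbar] bounds the quotients from above, so the second subderivative
   at [w] cannot be +oo. *)
have D2ub : \forall k \near \oo, D2 k <= 2 * dot (Z k) (W k) + r * enorm (W k) ^+ 2.
  apply: filterS near_prox => k /(_ xbar); rewrite /cball/= subrr enorm0 => /(_ (ltW eps0)).
  have -> : xbar - u k = - (t k *: W k) by rewrite /u opprD addNKr.
  rewrite enormN enormZ gtr0_norm// /s dotNr !dotE xa -[psi (u k)]fineK// -EFinD lee_fin.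
  move=> h; rewrite -(ler_pM2r (T0 k)) D2eq; move: h; rewrite exprMn; lra.
have [d dE] : exists d : R, second_subderiv psi xbar v w = d%:E \/
    second_subderiv psi xbar v w = -oo%E.
  case E : (second_subderiv psi xbar v w) => [d| |]; last by exists 0; right.
    by exists d; left.
  exfalso; pose M := 2 * dot z w + r * enorm w ^+ 2 + 1.
  have h1 : \forall k \near \oo, M < D2 k by apply: near_D2; rewrite E ltry.
  have h2 : \forall k \near \oo, 2 * dot (Z k) (W k) + r * enorm (W k) ^+ 2 < M.
    apply: (cvgr_lt (2 * dot z w + r * enorm w ^+ 2)); last by rewrite /M ltrDl.
    by apply: cvgD; apply: cvgM => //; exact: cvg_cst.
  have [k [[k1 k2] k3]] := filter_ex (filterI (filterI h1 h2) D2ub).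
  by move: k1 k2 k3; lra.
case: dE => [dE|->]; last by rewrite leNye.
(* The prox-regularity inequality from [u k] to [xbar + t k *: (lam *: y k)], divided by [t k ^+ 2]
   and taken with limits up to [e]; the recovery sequence [y] belongs to the step sizes
   [lam * t k]. *)
have key lam e : 0 < lam -> lam < 1 -> 0 < e ->
    2^-1 * (d - e) + (lam - 1) * dot z w - r / 2 * (1 - lam) ^+ 2 * enorm w ^+ 2 - e <=
    2^-1 * lam ^+ 2 * (d + e).
  move=> lam0 lam1 e0.
  have lt0 k : 0 < lam * t k by rewrite mulr_gt0.
  have ltcvg : (fun k => lam * t k) @ \oo --> 0.
    by rewrite -(mulr0 lam); apply: cvgM => //; exact: cvg_cst.
  have [y ycvg yq] := epi w _ lt0 ltcvg.
  have h1 : \forall k \near \oo,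
      (second_diff_quot psi xbar v (lam * t k) (y k) < (d + e)%:E)%E.
    rewrite dE in yq.
    have h : open_nbhs d%:E [set q : \bar R | (q < (d + e)%:E)%E].
      by split; [exact: open_ereal_lt_ereal|rewrite /= lte_fin ltrDl].
    exact: (yq _ (open_nbhs_nbhs h)).
  have h2 : \forall k \near \oo, d - e < D2 k.
    by apply: near_D2; rewrite dE lte_fin ltrBlDr ltrDl.
  have dcvg : (fun k => lam *: y k - W k) @ \oo --> lam *: w - w.
    by apply: cvgB => //; apply: cvgZ => //; exact: cvg_cst.
  pose rem k := dot (Z k) (lam *: y k - W k) - r / 2 * enorm (lam *: y k - W k) ^+ 2.
  have h3 : \forall k \near \oo,
      (lam - 1) * dot z w - r / 2 * (1 - lam) ^+ 2 * enorm w ^+ 2 - e < rem k.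
    have remcvg : rem @ \oo --> dot z (lam *: w - w) - r / 2 * enorm (lam *: w - w) ^+ 2.
      apply: cvgB; first exact: cvg_dot.
      apply: cvgM; first exact: cvg_cst.
      by apply: cvgM; exact: cvg_enorm.
    have E : (lam - 1) * dot z w - r / 2 * (1 - lam) ^+ 2 * enorm w ^+ 2 =
        dot z (lam *: w - w) - r / 2 * enorm (lam *: w - w) ^+ 2.
      have -> : lam *: w - w = (lam - 1) *: w by rewrite scalerBl scale1r.
      rewrite dotZr enormZ exprMn real_normK ?num_real//; ring.
    by rewrite E; apply: cvgr_gt remcvg _ _; rewrite ltrBlDr ltrDl.
  have xcvg : (fun k => xbar + t k *: (lam *: y k)) @ \oo --> xbar.
    by apply: (shift_cvg _ (lam *: w)); apply: cvgZ => //; exact: cvg_cst.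
  move/cvg_enormP : xcvg => /(_ eps eps0) h4.
  have [k [[k1 k2] [[k3 k4] k5]]] :=
    filter_ex (filterI (filterI h1 h2) (filterI (filterI h3 h4) near_prox)).
  have := k5 _ (ltW k4).
  have -> : xbar + t k *: (lam *: y k) - u k = t k *: (lam *: y k - W k).
    by rewrite /u opprD addrACA subrr add0r -scalerBr.
  move: k1; rewrite /second_diff_quot xa [lam * t k]mulrC -scalerA.
  have TL : 0 < 2^-1 * (t k * lam) ^+ 2 by rewrite mulr_gt0 ?exprn_gt0 ?mulr_gt0.
  rewrite -[psi (u k)]fineK//.
  case: (psi (xbar + _)) (psiN (xbar + t k *: (lam *: y k))) => [c| |] // _; last first.
    by rewrite /= gt0_mulye ?lte_fin ?invr_gt0// ltNge leey.
  rewrite -!EFinD -EFinM lte_fin lee_fin ltr_pdivrMr// => k1.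
  rewrite enormZ gtr0_norm// /s dotZr dotDl dotZl dotDr dotNr dotZr exprMn => k6.
  have tt : 0 < t k ^+ 2 by rewrite exprn_gt0.
  have k2' : (d - e) * (2^-1 * t k ^+ 2) < D2 k * (2^-1 * t k ^+ 2) by rewrite ltr_pM2r.
  rewrite D2eq in k2'.
  have k3' : t k ^+ 2 * ((lam - 1) * dot z w -
      r / 2 * (1 - lam) ^+ 2 * enorm w ^+ 2 - e) < t k ^+ 2 * rem k by rewrite ltr_pM2l.
  rewrite -(ler_pM2l tt); apply: ltW; move: k1 k2' k3' k6.
  rewrite /rem dotDr dotNr dotZr exprMn; lra.
rewrite dE lee_fin leNgt; apply/negP => zd.
pose g := d - dot z w; have g0 : 0 < g by rewrite subr_gt0.
pose M := `|d| + r * enorm w ^+ 2 + 1.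
have M0 : 0 < M.
  by rewrite ltr_wpDl// addr_ge0// mulr_ge0 ?sqr_ge0// ltW.
(* For [lam = 1 - mu] and error [e], [key] says that [mu * g] is at most [mu^2 * M / 2 + 2 * e] (up
   to enlarging constants). With [mu * M <= g] and [e = mu * g / 8] this is at most three quarters
   of [mu * g]. *)
pose mu := Num.min (1 / 2) (g / M).
have mu0 : 0 < mu by rewrite lt_min !divr_gt0.
have mu1 : mu <= 1 / 2 by rewrite /mu ge_min lexx.
have muM : mu * M <= g by rewrite -ler_pdivlMr// /mu ge_min lexx orbT.
have e0 : 0 < mu * g / 8 by rewrite divr_gt0 ?mulr_gt0.
have := key (1 - mu) (mu * g / 8); rewrite subr_gt0 ltrBlDr ltrDl.
have -> : mu < 1 by lra.
move=> /(_ isT mu0 e0).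
have h1 : mu * (mu * M) <= mu * g by rewrite ler_pM2l.
have h2 : mu ^+ 2 * d <= mu ^+ 2 * `|d| by rewrite ler_wpM2l ?sqr_ge0 ?ler_norm.
have h3 : (1 - mu) ^+ 2 * (mu * g / 8) <= 1 * (mu * g / 8).
  by rewrite ler_pM2r//; nra.
have h4 : 0 < mu * g by rewrite mulr_gt0.
by move: h1 h2 h3 h4; rewrite /M /g; nra.
Qed.

(** By homogeneity, the second subderivative of [psi] plus the form of [B], the symmetric part of
    [A] minus [m] times the identity, is nonnegative everywhere and zero at [w0]. Its optimality
    condition gives the tangent vector [- (B *m w0)], whose pairing with [w0] produces exactly
    [m]. *)
Lemma sphere_min_direction (R : realType) (n : nat) (f phi psi : 'cV[R]_n -> \bar R)
    (xbar : 'cV[R]_n) (A : 'M[R]_n) (r : R) (w0 : 'cV[R]_n) (m : R) :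
  (forall x, psi x <> -oo%E) -> psi xbar \is a fin_num ->
  (forall x, f x = (phi x + psi x)%E) -> is_ext_hessian phi xbar A ->
  (\forall x \near xbar, lsc_at psi x) ->
  (forall w, ((- (r * enorm w ^+ 2))%:E <=
    second_subderiv psi xbar (- gradient phi xbar) w)%E) ->
  enorm w0 = 1 ->
  (forall w, enorm w = 1 ->
    (second_subderiv f xbar 0 w0 <= second_subderiv f xbar 0 w)%E) ->
  second_subderiv f xbar 0 w0 = m%:E ->
  (forall w, ((m * enorm w ^+ 2)%:E <= second_subderiv f xbar 0 w)%E) /\
  exists2 z, subgrad_graph_deriv psi xbar (- gradient phi xbar) w0 z &
    dot (A *m w0) w0 + dot z w0 = m.
Proof.
move=> psiN psix fE hA psil psige w01 w0min w0m.
set v := - gradient phi xbar in psige *.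
have qE w : second_subderiv f xbar 0 w =
    ((dot (A *m w) w)%:E + second_subderiv psi xbar v w)%E.
  exact: second_subderiv_sum psiN psix fE hA w.
have qge w : ((m * enorm w ^+ 2)%:E <= second_subderiv f xbar 0 w)%E.
  (* Direction 0 is not a multiple of a unit vector; there the bound comes from [psige]. *)
  have [->|wn0] := eqVneq w 0.
    rewrite qE mulmx0 dot0l add0e enorm0 expr0n mulr0.
    by have := psige 0; rewrite enorm0 expr0n mulr0 oppr0.
  have wpos : 0 < enorm w by rewrite enorm_gt0.
  have -> : w = enorm w *: ((enorm w)^-1 *: w).
    by rewrite scalerA divff ?scale1r// gt_eqF.
  have u1 := enorm_normalize wn0.
  rewrite enormZ u1 mulr1 gtr0_norm// mulrC.
  by apply: second_subderivZ_ge => //; rewrite -w0m; exact: w0min.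
split=> //.
pose S := 2^-1 *: (A + A^T).
have Sdot w : dot (S *m w) w = dot (A *m w) w.
  rewrite /S -scalemxAl mulmxDl !dotE [dot (A^T *m w) w]dotC -dot_mulmx.
  by field.
pose B := S - m%:M.
have BT : B^T = B.
  by rewrite /B linearB/= tr_scalar_mx /S linearZ/= linearD/= trmxK [A^T + A]addrC.
have Bdot w : dot (B *m w) w = dot (A *m w) w - m * enorm w ^+ 2.
  by rewrite /B mulmxBl mul_scalar_mx !dotE Sdot enorm_sqr.
exists (- (B *m w0)); last by rewrite dotNl Bdot w01; ring.
have Bge w : ((- dot (B *m w) w)%:E <= second_subderiv psi xbar v w)%E.
  have := qge w; rewrite qE addeC -leeBlDr// -EFinB Bdot => H; apply: le_trans H.
  by rewrite lee_fin; lra.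
have Ble : (second_subderiv psi xbar v w0 <= (- dot (B *m w0) w0)%:E)%E.
  have : ((dot (A *m w0) w0)%:E + second_subderiv psi xbar v w0 <= m%:E)%E.
    by rewrite -qE w0m.
  rewrite addeC -leeBrDr// -EFinB => /le_trans; apply.
  by rewrite lee_fin Bdot w01; lra.
apply: tangent_graphI => e e0.
have [t [w' [z [t0 te we ze sub]]]] :=
  second_subderiv_min_reg_subdiff BT psiN psix psil Bge Ble e0.
by exists t, w', z; rewrite opprK; split=> //; exact: reg_subdiff_lim.
Qed.

(** * The equivalences and the exact modulus *)

Theorem theorem4p1 (R : realType) (n : nat) (xbar : 'cV[R]_n)
    (f phi psi : 'cV[R]_n -> \bar R)
    (phi_ninfty : forall x, phi x <> -oo%E)
    (psi_ninfty : forall x, psi x <> -oo%E)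
    (f_sum : forall x, f x = (phi x + psi x)%E)
    (phi_twice : ext_twice_differentiable phi xbar)
    (stationary : [set gradient phi xbar + v | v in lim_subdiff psi xbar] 0)
    (psi_lsc : lsc_around psi xbar)
    (psi_subcont : subdiff_continuous psi xbar (- gradient phi xbar))
    (psi_prox : prox_regular psi xbar (- gradient phi xbar))
    (psi_epi : twice_epi_differentiable psi xbar (- gradient phi xbar)) :
  let A := ext_hessian phi xbar in
  let d2psi := second_subderiv psi xbar (- gradient phi xbar) in
  let Dpsi := subgrad_graph_deriv psi xbar (- gradient phi xbar) in
  let i := exists kappa gamma : R,
    [/\ 0 < kappa, 0 < gamma & growth_on_ball f xbar kappa gamma] in
  let ii := strongly_subregular (lim_subdiff f) xbar 0 /\
    (forall w, (0 <= (dot (A *m w) w)%:E + d2psi w)%E) in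
  let iii := strongly_subregular (lim_subdiff f) xbar 0 /\
    local_minimizer f xbar in
  let iv := forall w, mdom Dpsi w -> w <> 0 -> forall z, Dpsi w z ->
    0 < dot (A *m w) w + dot z w in
  let v := exists2 c : R, 0 < c &
    forall w, mdom Dpsi w -> forall z, Dpsi w z ->
      c * enorm w ^+ 2 <= dot (A *m w) w + dot z w in
  let vi := forall w, w <> 0 -> (0 < (dot (A *m w) w)%:E + d2psi w)%E in
  [<-> i; ii; iii; iv; v; vi] /\
  ([\/ i, ii, iii | [\/ iv, v | vi]] ->
   QG f xbar =
   ereal_inf [set q | exists w z : 'cV[R]_n,
     [/\ mdom Dpsi w, Dpsi w z &
         q = ediv0 (dot (A *m w) w + dot z w) (enorm w ^+ 2)]]).
Proof.
move=> A d2psi Dpsi i ii iii iv v vi.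
have hA : is_ext_hessian phi xbar A := xgetPex 0 phi_twice.
have [[phif _] _] := hA.
have phix : phi xbar \is a fin_num by exact: nbhs_singleton phif.
have psix : psi xbar \is a fin_num.
  have [+ _ _] := psi_prox; rewrite /edom/=.
  by move: (psi_ninfty xbar); case: (psi xbar).
have fx : f xbar \is a fin_num by rewrite f_sum fin_numD phix psix.
have psil : \forall x \near xbar, lsc_at psi x by exact: psi_lsc.
have fN x : f x <> -oo%E.
  rewrite f_sum; move: (phi_ninfty x) (psi_ninfty x).
  by case: (phi x) (psi x) => [a| |] [b| |].
have fl : \forall x \near xbar, lsc_at f x by exact: lsc_sum_near f_sum hA psil.
pose q w := second_subderiv f xbar 0 w.
have qE w : q w = ((dot (A *m w) w)%:E + d2psi w)%E.
  exact: second_subderiv_sum psi_ninfty psix f_sum hA w.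
have [r rge] := prox_second_subderiv_ge psi_ninfty psi_prox.
have qN w : q w <> -oo%E.
  rewrite qE; have := rge w; rewrite -/d2psi.
  by case: (d2psi w).
have qD w z : Dpsi w z -> (q w <= (dot (A *m w) w + dot z w)%:E)%E.
  move=> wz; rewrite qE EFinD leeD2l//.
  exact: second_subderiv_le_graph_deriv psi_ninfty psi_subcont psi_prox psi_epi wz.
have unit_min : (exists w : 'cV[R]_n, w != 0) -> exists2 w0, enorm w0 = 1 &
    forall w, enorm w = 1 -> (q w0 <= q w)%E.
  move=> [w wn0].
  have [|x _|w0 w01 w0min] := lsc_attains_min (F := q) (@compact_sphere _ _ (0 : 'cV[R]_n) 1).
  - by exists ((enorm w)^-1 *: w); rewrite /= subr0 enorm_normalize.
  - exact: lsc_second_subderiv.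
  exists w0; first by move: w01; rewrite /= subr0.
  by move=> u u1; apply: w0min; rewrite /= subr0.
have direction w0 m := @sphere_min_direction _ _ f phi psi xbar A r w0 m
  psi_ninfty psix f_sum hA psil rge.
have i_growth kappa gamma : 0 < gamma -> growth_on_ball f xbar kappa gamma ->
    forall w, ((kappa * enorm w ^+ 2)%:E <= q w)%E.
  by move=> g0 gr w; exact: growth_second_subderiv g0 gr.
have i_v : i -> v.
  move=> [kappa [gamma [k0 g0 gr]]]; exists kappa => // w _ z wz.
  by rewrite -lee_fin; apply: le_trans (qD w z wz); exact: (i_growth _ _ g0 gr w).
have v_iv : v -> iv.
  move=> [c c0 cv] w wdom wn0 z wz; apply: lt_le_trans (cv w wdom z wz).
  by rewrite mulr_gt0// exprn_gt0// enorm_gt0; apply/eqP.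
have iv_vi : iv -> vi.
  move=> hiv w /eqP wn0; rewrite -qE.
  have wpos : 0 < enorm w by rewrite enorm_gt0.
  have [w0 w01 w0min] := unit_min (ex_intro _ w wn0).
  have w0n0 := enorm1_neq0 w01.
  case E : (q w0) (qN w0) => [m| |] // _.
    have [qge [z zD zm]] := direction _ _ w01 w0min E.
    have m0 : 0 < m by rewrite -zm; apply: hiv => //; exists z.
    by apply: lt_le_trans (qge w); rewrite lte_fin mulr_gt0// exprn_gt0.
  (* If the minimum on the sphere is +oo, any positive constant bounds [q] below there, and scaling
     reaches [w]. *)
  have u1 := enorm_normalize wn0.
  have : (1%:E <= q ((enorm w)^-1 *: w))%E.
    by apply: le_trans (w0min _ u1); rewrite E leey.
  move=> /(second_subderivZ_ge wpos); rewrite scalerA divff ?gt_eqF// scale1r.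
  by apply: lt_le_trans; rewrite lte_fin mulr1 exprn_gt0.
have vi_i : vi -> i.
  move=> hvi; have [ex|nex] := pselect (exists w : 'cV[R]_n, w != 0).
    have [w0 w01 w0min] := unit_min ex.
    have w0n0 := enorm1_neq0 w01.
    have := hvi w0 w0n0; rewrite -qE => /lte_dense_EFin[c c0 cq].
    have [|gamma g0 gr] := @second_subderiv_growth _ _ f xbar c fx.
      by move=> w /w0min; exact: lt_le_trans.
    by exists c, gamma.
  (* In dimension 0 the unit sphere is empty and the constant 1 serves. *)
  have [|gamma g0 gr] := @second_subderiv_growth _ _ f xbar 1 fx.
    move=> w w1; exfalso; apply: nex; exists w.
    by rewrite -enorm_gt0 w1.
  by exists 1, gamma.
have i_min : i -> local_minimizer f xbar.
  move=> [kappa [gamma [k0 g0 gr]]]; apply/nbhs_enormP; exists gamma => // x xg.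
  have := gr x (ltW xg); have : 0 <= kappa / 2 * enorm (x - xbar) ^+ 2.
    by rewrite mulr_ge0 ?sqr_ge0 ?divr_ge0 ?ltW.
  rewrite -lee_fin => h1 /(le_trans h1).
  by rewrite sube_ge0// fx.
have i_iii : i -> iii.
  move=> hi; have fmin := i_min hi; split=> //.
  apply: (strongly_subregular_sum psi_ninfty f_sum hA psil).
    move=> w w1 wD.
    have wn0 := enorm1_neq0 w1.
    have := v_iv (i_v hi) w (ex_intro _ _ wD) wn0 _ wD.
    by rewrite dotNl subrr ltxx.
  apply/reg_subdiff_lim/(@reg_subdiffI _ _ _ _ _ 0) => //.
  by apply: filterS fmin => y; rewrite dot0l mul0r subrr adde0.
have iii_ii : iii -> ii.
  move=> [reg fmin]; split=> // w; rewrite -qE.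
  have [e e0 he] := (nbhs_enormP xbar _).1 fmin.
  (* Local minimality is growth with constant 0. *)
  have gr : growth_on_ball f xbar 0 (e / 2).
    move=> x xe; rewrite !mul0r sube_ge0 ?fx//; apply: he.
    by apply: le_lt_trans xe _; lra.
  by have := i_growth 0 (e / 2) (divr_gt0 e0 (ltr0Sn _ 1)) gr w; rewrite mul0r.
have ii_vi : ii -> vi.
  move=> [[_ [kappa k0 /nbhs_enormP[d d0 hd]]] qge] w /eqP wn0.
  have wpos : 0 < enorm w by rewrite enorm_gt0.
  rewrite -qE lt_def; apply/andP; split; last by rewrite qE.
  apply/eqP => qw0.
  (* Subregularity at [xbar + t *: w'] with subgradient [t *: z] gives [enorm w' < kappa * e], hence
     [enorm w < (kappa + 1) * e], against the second bound; the first and third keep the point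
     within [d] of [xbar]. *)
  pose e := Num.min 1 (Num.min (enorm w / (kappa + 1)) (d / (enorm w + 1))).
  have k1 : 0 < kappa + 1 by rewrite addr_gt0.
  have w1 : 0 < enorm w + 1 by rewrite addr_gt0.
  have e0 : 0 < e by rewrite !lt_min ltr01 !divr_gt0.
  have e1 : e <= 1 by rewrite /e ge_min lexx.
  have ek : e * (kappa + 1) <= enorm w.
    by rewrite -ler_pdivlMr// /e !ge_min lexx orbT.
  have ed : e * (enorm w + 1) <= d.
    by rewrite -ler_pdivlMr// /e !ge_min lexx !orbT.
  have B0 (u : 'cV[R]_n) : dot ((0 : 'M[R]_n) *m u) u = 0 by rewrite mul0mx dot0l.
  have [||t [w' [z [t0 te w'w ze sub]]]] :=
    @second_subderiv_min_reg_subdiff _ _ f xbar 0 w 0 (trmx0 _ _ _) fN fx fl _ _ e e0.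
  - by move=> u; rewrite B0 oppr0 -/(q u) qE.
  - by rewrite B0 oppr0 -/(q w) qw0.
  rewrite mul0mx addr0 in ze; rewrite add0r in sub.
  have w'le : enorm w' < enorm w + 1.
    rewrite -[w'](subrK w) addrC; apply: le_lt_trans (ler_enormD _ _) _.
    by rewrite ltrD2l; exact: lt_le_trans e1.
  have xE : enorm (xbar + t *: w' - xbar) = t * enorm w'.
    by rewrite addrC addKr enormZ gtr0_norm.
  have tw'd : t * enorm w' < d.
    apply: lt_le_trans ed; apply: (@lt_trans _ _ (t * (enorm w + 1))).
      by rewrite ltr_pM2l.
    by rewrite ltr_pM2r.
  have := hd (xbar + t *: w'); rewrite xE => /(_ tw'd).
  have : (Defs.edist 0%R (lim_subdiff f (xbar + t *: w')) <= (t * enorm z)%:E)%E.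
    apply: ereal_inf_lbound; exists (t *: z); first exact: reg_subdiff_lim.
    by rewrite sub0r enormN enormZ gtr0_norm.
  have kge0 : (0 <= kappa%:E)%E by rewrite lee_fin ltW.
  move=> /(lee_wpmul2l kge0) h1 /le_trans /(_ h1).
  rewrite -EFinM lee_fin mulrCA ler_pM2l// => h2.
  have h3 := ler_enormD w' (w - w'); rewrite addrC subrK enormB in h3.
  have : kappa * enorm z < kappa * e by rewrite ltr_pM2l.
  by move: ek; lra.
(* The implications at hand, [i -> v -> iv -> vi -> i] and [i -> iii -> ii -> vi], connect all six
   assertions. *)
split; first by tfae; tauto.
move=> some.
have hi : i by case: some => [||| []] h; tauto.
have hv := i_v hi; have hvi := iv_vi (v_iv hv).
(* [QG] is a supremum over positive constants only, so the [c] chosen above it later must be known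
   to be positive in order to compete. *)
have QGpos : (0 < QG f xbar)%E.
  have [kappa [gamma [k0 g0 gr]]] := hi.
  apply: (@lt_le_trans _ _ kappa%:E); first by rewrite lte_fin.
  by apply: ereal_sup_ubound; exists kappa => //; split=> //; exists gamma.
apply/eqP; rewrite eq_le; apply/andP; split.
  apply: ge_ereal_sup => _ [kappa [k0 [gamma g0 gr]] <-].
  apply: le_ereal_inf_tmp => _ [w [z [_ wz ->]]]; rewrite /ediv0.
  have [->|wn0] := eqVneq w 0.
    by rewrite mulmx0 dot0l dot0r enorm0 expr0n addr0 eqxx leey.
  have wpos : 0 < enorm w ^+ 2 by rewrite exprn_gt0// enorm_gt0.
  rewrite (gt_eqF wpos) andbF lee_fin ler_pdivlMr//.
  by rewrite -lee_fin; apply: le_trans (qD w z wz); exact: (i_growth _ _ g0 gr w).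
(* A constant [c] strictly between the two sides lies below the minimum of [q] on the sphere, as
   [direction] realizes a finite minimum by one of the quotients. Then [c] is a growth constant
   above the supremum. *)
rewrite leNgt; apply/negP => /lte_dense_EFin[c QGc cI].
have c0 : 0 < c by rewrite -lte_fin; exact: lt_trans QGc.
have [|gamma g0 gr] := @second_subderiv_growth _ _ f xbar c fx.
  move=> w w1.
  have wn0 : w != 0 by rewrite -enorm_gt0 w1.
  have [w0 w01 w0min] := unit_min (ex_intro _ w wn0).
  apply: lt_le_trans (w0min w w1).
  case E : (q w0) (qN w0) => [m| |] // _; last exact: ltry.
  have [_ [z zD zm]] := direction _ _ w01 w0min E.
  apply: (lt_le_trans cI); apply: ereal_inf_lbound; exists w0, z; split=> //.
    by exists z.
  by rewrite /ediv0 w01 expr1n oner_eq0 andbF divr1 zm.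
have : (c%:E <= QG f xbar)%E.
  by apply: ereal_sup_ubound; exists c => //; split=> //; exists gamma.
by rewrite leNgt QGc.
Qed.
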